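(* Let $n\ge1$, $q\in(0,n/2)$, $\gamma\in[0,n)$, and let $$1<p<p_{\mathrm{crit}}(n,q,\gamma):=1+\frac{2+\gamma}{n-q}.$$ Let $(u_0,u_1)\in\mathcal{Y}^q(\mathbb{R}^n)\times\mathcal{Y}^q(\mathbb{R}^n)$ be such that, for some constant $c>0$, $u_0(x)+u_1(x)\ge c\,\langle x\rangle^{-n+q}$ for $x\in\mathbb{R}^n$, where $\langle x\rangle=(1+|x|^2)^{1/2}$. Then there exist constants $\varepsilon_1>0$ and $C>0$ such that for all $\varepsilon\in(0,\varepsilon_1]$ the lifespan $T_{\varepsilon,w}$ of local (in time) weak solutions to $$\begin{cases}u_{tt}-\Delta u+u_t=\mathcal{I}_\gamma(|u|^p), & x\in\mathbb{R}^n,\ t>0,\\ u(0,x)=\varepsilon u_0(x),\quad u_t(0,x)=\varepsilon u_1(x), & x\in\mathbb{R}^n,\end{cases}$$ satisfies $$T_{\varepsilon,w}\ \le\ C\,\varepsilon^{-\frac{2(p-1)}{2+\gamma-(p-1)(n-q)}}.$$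
   Context: Riesz potential: for $0<\gamma<n$, $\mathcal{I}_\gamma f(x)=C_{n,\gamma}\int_{\mathbb{R}^n}|x-y|^{-(n-\gamma)}f(y)\,dy$ with $C_{n,\gamma}=\Gamma(\frac{n-\gamma}{2})/(2^\gamma\pi^{n/2}\Gamma(\frac\gamma2))$, taken in the space variable; $\mathcal{I}_0$ is the identity. Pseudo-measure space: $\mathcal{Y}^q(\mathbb{R}^n)$ is the set of tempered distributions $f$ with $\widehat f\in L^1_{\mathrm{loc}}(\mathbb{R}^n)$ and $\|f\|_{\mathcal{Y}^q}:=\sup_{\xi\in\mathbb{R}^n}|\xi|^q|\widehat f(\xi)|<\infty$. The data $u_0,u_1$ are understood to be (locally integrable) functions, so that the pointwise lower bound makes sense. Weak solution: for $T\in(0,\infty]$, $u\in\mathcal{C}([0,T),L^2(\mathbb{R}^n))$ is a weak solution on $[0,T)$ if for all $\chi\in\mathcal{C}_0^\infty([0,T))$ and $\phi\in\mathcal{C}_0^\infty(\mathbb{R}^n)$ $$\int_0^T\!\!\int_{\mathbb{R}^n}\mathcal{I}_\gamma(|u|^p)(t,x)\,\phi(x)\chi(t)\,dx\,dt=\int_0^T\!\!\int_{\mathbb{R}^n}(\partial_t^2-\Delta+\partial_t)u(t,x)\,\phi(x)\chi(t)\,dx\,dt,$$ where the right-hand side is understood after integrating by parts and using the initial conditions, i.e. $$\int_0^T\!\!\int\mathcal{I}_\gamma(|u|^p)\phi\chi\,dx\,dt+\varepsilon\chi(0)\int(u_0+u_1)\phi\,dx-\varepsilon\chi'(0)\int u_0\phi\,dx=\int_0^T\!\!\int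 u\,\big(\phi\chi''-\phi\chi'-\chi\Delta\phi\big)\,dx\,dt$$ (it is part of the definition that the integrals are well defined and finite). Here $\mathcal{C}_0^\infty([0,T))$ denotes smooth functions on $[0,T)$ with compact support in $[0,T)$ (not necessarily vanishing at $0$). Lifespan: $T_{\varepsilon,w}$ is the supremum of all $T>0$ for which there exists a weak solution on $[0,T)$ for the given $\varepsilon$ (with the convention $\sup\emptyset=0$). The constants $\varepsilon_1,C$ may depend on $n,q,\gamma,p$ and the data $u_0,u_1$, but $C$ does not depend on $\varepsilon$. *)

(* Defs.v *)
From HB Require Import structures.
From mathcomp Require Import all_boot all_order all_algebra.
From mathcomp.real_closed Require Import complex.
From mathcomp Require Import all_classical all_reals all_analysis.
From mathcomp Require Import ess_sup_inf.

Set Implicit Arguments.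
Unset Strict Implicit.
Unset Printing Implicit Defensive.

Import Order.TTheory GRing.Theory Num.Theory.
Import numFieldNormedType.Exports.

Local Open Scope classical_set_scope.
Local Open Scope ring_scope.

(* R^n is 'rV[R]_n, with the sigma-algebra generated by the coordinate maps
   (the Borel sets), as the library does for n.-tuple. *)

Definition rV_display : measure_display.
Proof. exact: default_measure_display. Qed.

Section measurable_rV.
Context {R : realType} (n : nat).

Definition rV_coord (i : 'I_n) (x : 'rV[R]_n) : measurableTypeR R := x ord0 i.

Let rV_set0 : g_sigma_preimage rV_coord set0.
Proof. exact: sigma_algebra0. Qed.

Let rV_setC A : g_sigma_preimage rV_coord A -> g_sigma_preimage rV_coord (~` A).
Proof. exact: sigma_algebraC. Qed.

Let rV_bigcup (F : (set 'rV[R]_n)^nat) :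
  (forall i, g_sigma_preimage rV_coord (F i)) ->
  g_sigma_preimage rV_coord (\bigcup_i (F i)).
Proof. exact: sigma_algebra_bigcup. Qed.

HB.instance Definition _ := @isMeasurable.Build rV_display
  'rV[R]_n (g_sigma_preimage rV_coord) rV_set0 rV_setC rV_bigcup.

Lemma measurable_rV_coord i :
  measurable_fun [set: 'rV[R]_n] (rV_coord i).
Proof.
move=> _ Y mY; rewrite setTI; apply: sub_sigma_algebra => /=.
rewrite -bigcup_seq/=; exists i => /=; first by rewrite mem_index_enum.
by exists Y => //; rewrite setTI.
Qed.

Lemma measurable_fun_rVP d (T : measurableType d) (f : T -> 'rV[R]_n) :
  (forall i, measurable_fun [set: T] (rV_coord i \o f)) ->
  measurable_fun [set: T] f.
Proof.
move=> mf.
suff mg : g_sigma_preimage (fun i => rV_coord i \o f) `<=` measurable.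
  move=> _ A mA; rewrite setTI; apply: mg.
  by rewrite g_sigma_preimage_comp; exists A => //; rewrite setTI.
apply: smallest_sub; first exact: sigma_algebra_measurable.
rewrite -bigcup_seq => A /= [i _] [B mB <-].
exact: mf.
Qed.

End measurable_rV.

Section rV_cons.
Context {R : realType} (n : nat).

Definition rV_cons (z : measurableTypeR R * 'rV[R]_n) : 'rV[R]_n.+1 :=
  \row_(i < n.+1) oapp (z.2 ord0) z.1 (unlift ord0 i).

Lemma measurable_rV_cons : measurable_fun [set: _] rV_cons.
Proof.
apply: measurable_fun_rVP => i.
case: (unliftP ord0 i) => [j ->|->].
  rewrite (_ : _ \o _ = rV_coord j \o snd).
    apply: measurableT_comp; last exact: measurable_snd.
    exact: measurable_rV_coord.
  by apply/funext => z /=; rewrite /rV_coord /rV_cons mxE liftK.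
rewrite (_ : _ \o _ = fst); first exact: measurable_fst.
by apply/funext => z /=; rewrite /rV_coord /rV_cons mxE unlift_none.
Qed.

Definition rV_uncons (x : 'rV[R]_n.+1) : measurableTypeR R * 'rV[R]_n :=
  (x ord0 ord0, \row_(j < n) x ord0 (lift ord0 j)).

Lemma measurable_rV_uncons : measurable_fun [set: _] rV_uncons.
Proof.
apply/measurable_fun_pairP; split; first exact: measurable_rV_coord.
apply: measurable_fun_rVP => i.
rewrite (_ : _ \o _ = rV_coord (lift ord0 i)); first exact: measurable_rV_coord.
by apply/funext => x /=; rewrite /rV_coord mxE.
Qed.

Lemma rV_consK : cancel rV_cons rV_uncons.
Proof.
move=> [a v]; rewrite /rV_cons /rV_uncons mxE unlift_none; congr pair.
by apply/rowP => j; rewrite !mxE liftK.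
Qed.

Variable mu : {sigma_finite_measure set 'rV[R]_n -> \bar R}.

Definition rV_cons_measure : set 'rV[R]_n.+1 -> \bar R :=
  pushforward (@lebesgue_measure R \x mu)%E rV_cons.

Local Notation nu := rV_cons_measure.

Let nu0 : nu set0 = 0%E.
Proof. by rewrite /nu /pushforward preimage_set0 measure0. Qed.

Let nu_ge0 A : (0 <= nu A)%E.
Proof. by rewrite /nu /pushforward measure_ge0. Qed.

Let nu_sigma_additive : semi_sigma_additive nu.
Proof.
move=> F mF tF mUF; rewrite /nu /pushforward preimage_bigcup.
apply: measure_semi_sigma_additive.
- by move=> i; rewrite -[X in measurable X]setTI; exact: measurable_rV_cons.
- apply/trivIsetP => /= i j _ _ ij; rewrite -preimage_setI.
  by move/trivIsetP : tF => /(_ _ _ _ _ ij) ->//; rewrite preimage_set0.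
- rewrite -preimage_bigcup -[X in measurable X]setTI.
  exact: measurable_rV_cons.
Qed.

HB.instance Definition _ := isMeasure.Build _ _ _ nu
  nu0 nu_ge0 nu_sigma_additive.

Let nu_sigma_finite : sigma_finite setT nu.
Proof.
have /sigma_finiteP[F [TF ndF Foo]] := sigma_finiteT (@lebesgue_measure R).
have /sigma_finiteP[G [TG ndG Goo]] := sigma_finiteT mu.
exists (fun i => rV_uncons @^-1` (F i `*` G i)).
  rewrite -preimage_bigcup (_ : \bigcup_i _ = setT) ?preimage_setT//.
  rewrite -subTset => -[x y] _.
  have [i _ Fx] : (\bigcup_i F i) x by rewrite -TF.
  have [j _ Gy] : (\bigcup_i G i) y by rewrite -TG.
  exists (maxn i j) => //; split => /=.
    by move: x Fx; exact/subsetPset/ndF/leq_maxl.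
  by move: y Gy; exact/subsetPset/ndG/leq_maxr.
move=> i; have [mF Fi] := Foo i; have [mG Gi] := Goo i; split.
  rewrite -[X in measurable X]setTI; apply: measurable_rV_uncons => //.
  exact: measurableX.
rewrite /nu /pushforward -comp_preimage (_ : _ \o _ = id); last first.
  by apply/funext => z /=; rewrite rV_consK.
by rewrite preimage_id product_measure1E// lte_mul_pinfty// ge0_fin_numE.
Qed.

HB.instance Definition _ := Measure_isSigmaFinite.Build _ _ _ nu
  nu_sigma_finite.

End rV_cons.

(* Lebesgue measure on R^n as iterated product measure; R^0 is a unit point
   mass. *)
Fixpoint lebesgue_rV (R : realType) (n : nat) :
    {sigma_finite_measure set 'rV[R]_n -> \bar R} :=
  match n with
  | 0 => \d_(0 : 'rV[R]_0)
  | m.+1 => rV_cons_measure (lebesgue_rV R m)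
  end.

(* The library norm `|x| on 'rV[R]_n is the maximum norm. *)
Definition dotp {R : realType} {n : nat} (x y : 'rV[R]_n) : R :=
  \sum_(i < n) x ord0 i * y ord0 i.

Definition enorm {R : realType} {n : nat} (x : 'rV[R]_n) : R :=
  Num.sqrt (dotp x x).

Definition japanese {R : realType} {n : nat} (x : 'rV[R]_n) : R :=
  Num.sqrt (1 + enorm x ^+ 2).

Section test_functions.
Context {R : realType} {n : nat}.

Definition partial (i : 'I_n) (f : 'rV[R]_n -> R) : 'rV[R]_n -> R :=
  'D_(delta_mx ord0 i) f.

(* A multi-index is given by the list of the directions of differentiation. *)
Definition partials (s : seq 'I_n) (f : 'rV[R]_n -> R) : 'rV[R]_n -> R :=
  foldr partial f s.

Definition laplacian (f : 'rV[R]_n -> R) (x : 'rV[R]_n) : R :=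
  \sum_(i < n) partials [:: i; i] f x.

Definition smooth (f : 'rV[R]_n -> R) : Prop :=
  forall s : seq 'I_n, continuous (partials s f) /\
    forall (i : 'I_n) x, derivable (partials s f) x (delta_mx ord0 i).

Definition test_function (f : 'rV[R]_n -> R) : Prop :=
  smooth f /\ compact (closure [set x | f x != 0]).

(* C_0^oo([0,T)): an element is given by a smooth extension to R of a function
   on [0,T); its values outside [0,T) are irrelevant. *)
Definition time_interval (T : \bar R) : set R :=
  [set t | 0 <= t /\ (t%:E < T)%E].

Definition time_test_function (T : \bar R) (chi : R -> R) : Prop :=
  (forall (k : nat) (t : R), derivable (derive1n k chi) t 1) /\
  exists2 K, compact K & K `<=` time_interval T /\
    forall t, time_interval T t -> chi t != 0 -> K t.

End test_functions.

Section pseudo_measures.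
Context {R : realType} {n : nat}.
Local Notation mu := (lebesgue_rV R n).
Implicit Types (f g phi : 'rV[R]_n -> R[i]).
Local Open Scope complex_scope.

Definition cintegral (f : 'rV[R]_n -> R[i]) : R[i] :=
  Rintegral mu setT (fun x => complex.Re (f x)) +i*
  Rintegral mu setT (fun x => complex.Im (f x)).

Definition locally_integrable_rV (f : 'rV[R]_n -> R) : Prop :=
  measurable_fun [set: 'rV[R]_n] f /\
  forall K, compact K -> mu.-integrable K (EFin \o f).

Definition clocally_integrable f : Prop :=
  locally_integrable_rV (fun x => complex.Re (f x)) /\
  locally_integrable_rV (fun x => complex.Im (f x)).

Definition cpartials (s : seq 'I_n) f (x : 'rV[R]_n) : R[i] :=
  partials s (fun x => complex.Re (f x)) x +i*
  partials s (fun x => complex.Im (f x)) x.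

Definition csmooth f : Prop :=
  smooth (fun x => complex.Re (f x)) /\ smooth (fun x => complex.Im (f x)).

Definition ctest_function f : Prop :=
  test_function (fun x => complex.Re (f x)) /\
  test_function (fun x => complex.Im (f x)).

Definition schwartz_norm (N : nat) f : \bar R :=
  ereal_sup [set y | exists s x, (size s <= N)%N /\
    y = ((1 + enorm x) ^+ N * Normc.normc (cpartials s f x))%:E].

Definition schwartz f : Prop :=
  csmooth f /\ forall N, (schwartz_norm N f < +oo)%E.

(* Distributions are total on functions 'rV[R]_n -> R[i]; only their values on
   Schwartz functions are meaningful. *)
Definition tempered_distribution (F : ('rV[R]_n -> R[i]) -> R[i]) : Prop :=
  (forall (a : R[i]) phi psi, schwartz phi -> schwartz psi ->
     F (fun x => a * phi x + psi x) = a * F phi + F psi) /\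
  exists (N : nat) (M : R), forall phi, schwartz phi ->
    ((Normc.normc (F phi))%:E <= M%:E * schwartz_norm N phi)%E.

Definition represented_by (F : ('rV[R]_n -> R[i]) -> R[i]) g : Prop :=
  clocally_integrable g /\
  forall phi, ctest_function phi -> F phi = cintegral (fun x => g x * phi x).

Definition fourier phi (xi : 'rV[R]_n) : R[i] :=
  cintegral (fun x => (cos (dotp x xi) -i* sin (dotp x xi)) * phi x).

Definition fourier_distribution (F : ('rV[R]_n -> R[i]) -> R[i]) :
    ('rV[R]_n -> R[i]) -> R[i] :=
  fun phi => F (fourier phi).

(* The supremum over xi is essential: the Fourier transform is an element of
   L^1_loc, determined up to null sets. *)
Definition pseudo_measure (q : R) (F : ('rV[R]_n -> R[i]) -> R[i]) : Prop :=
  tempered_distribution F /\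
  exists Fhat, represented_by (fourier_distribution F) Fhat /\
    (ess_sup mu (fun xi => (enorm xi `^ q * Normc.normc (Fhat xi))%:E) < +oo)%E.

Definition pseudo_measure_function (q : R) (f : 'rV[R]_n -> R) : Prop :=
  exists F, pseudo_measure q F /\ represented_by F (fun x => (f x)%:C).

End pseudo_measures.

Definition Gamma {R : realType} (s : R) : R :=
  Rintegral lebesgue_measure `]0, +oo[ (fun t => t `^ (s - 1) * expR (- t)).

Section damped_wave.
Context {R : realType} {n : nat}.
Local Notation mu := (lebesgue_rV R n).
Implicit Types (gam p eps : R) (T : \bar R).

Definition riesz_const gam : R :=
  Gamma ((n%:R - gam) / 2) /
  (2 `^ gam * pi `^ (n%:R / 2) * Gamma (gam / 2)).

Definition riesz_potential gam (f : 'rV[R]_n -> R) (x : 'rV[R]_n) : \bar R :=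
  if gam == 0 then (f x)%:E else
  ((riesz_const gam)%:E *
   \int[mu]_y (enorm (x - y) `^ (- (n%:R - gam)) * f y)%R%:E)%E.

(* u is an element of C([0,T), L^2(R^n)), each u t being a representative of
   its class. *)
Definition continuous_L2 T (u : R -> 'rV[R]_n -> R) : Prop :=
  (forall t, time_interval T t -> u t \in Lfun mu 2%:E) /\
  forall t, time_interval T t ->
    ('N[mu]_2%:E[EFin \o (fun x => (u s x - u t x)%R)])%E
      @[s --> within (time_interval T) (nbhs t)] --> (0%E : \bar R).

Definition iterated_integrable T (F : R -> 'rV[R]_n -> \bar R) : Prop :=
  {ae lebesgue_measure, forall t, time_interval T t ->
    mu.-integrable setT (F t)} /\
  lebesgue_measure.-integrable (time_interval T)
    (fun t => \int[mu]_x F t x)%E.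

Definition iterated_integral T (F : R -> 'rV[R]_n -> \bar R) : \bar R :=
  (\int[lebesgue_measure]_(t in time_interval T) \int[mu]_x F t x)%E.

Definition weak_solution gam p eps (u0 u1 : 'rV[R]_n -> R) T
    (u : R -> 'rV[R]_n -> R) : Prop :=
  continuous_L2 T u /\
  forall (chi : R -> R) (phi : 'rV[R]_n -> R),
    time_test_function T chi -> test_function phi ->
    let nonlinear t x :=
      (riesz_potential gam (fun y => `|u t y| `^ p)%R x
        * (phi x * chi t)%:E)%E in
    let linear t x :=
      (u t x * (phi x * derive1n 2 chi t - phi x * derive1 chi t
                - chi t * laplacian phi x))%:E in
    [/\ iterated_integrable T nonlinear,
        iterated_integrable T linear,
        mu.-integrable setT (fun x => ((u0 x + u1 x) * phi x)%R%:E),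
        mu.-integrable setT (fun x => (u0 x * phi x)%R%:E) &
        (iterated_integral T nonlinear
         + (eps * chi 0)%R%:E * (\int[mu]_x ((u0 x + u1 x) * phi x)%R%:E)
         - (eps * derive1 chi 0)%R%:E * (\int[mu]_x (u0 x * phi x)%R%:E)
         = iterated_integral T linear)%E].

Definition lifespan gam p eps (u0 u1 : 'rV[R]_n -> R) : \bar R :=
  ereal_sup (0%E |` [set T | (0 < T)%E /\
    exists u, weak_solution gam p eps u0 u1 T u]).

End damped_wave.

Definition p_crit {R : realType} (n : nat) (q gam : R) : R :=
  1 + (2 + gam) / (n%:R - q).

(* Main.v *)
Require Import Defs.
From mathcomp Require Import all_boot all_order all_algebra.
From mathcomp Require Import all_classical all_reals all_analysis.
From mathcomp Require Import measurable_realfun ring lra.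

(* Test function method.  Fix [rho >= 1] with [rho^2 < T] and test the equation
   against [chi t = b (t / rho^2)] and [phi x = prod_i b (x_i / rho)], where
   [b s = exp (- 1 / (1 - s^2))] on [(-1, 1)].  Since [b^(1 - 1/p)] decays faster
   than any power of [1 - s^2], all derivatives of [b] are O(b^(1/p)), so that the
   linear term at time [t] is at most [C rho^-2 |u| (phi chi)^(1/p)].  On the
   support of [phi] the Riesz kernel is at least [C rho^(gam - n)], whence
   [int I_gam(|u|^p) phi >= C rho^gam int |u|^p phi]; by Young's inequality this
   absorbs the linear term up to [C rho^(n - 2 - (2 + gam)/(p - 1))] for each
   [t <= rho^2].  Integrating in time, the nonlinear term cancels and the data
   term, at least [C eps rho^q], remains:
   [eps rho^q <= C rho^(n - (2 + gam)/(p - 1))], which bounds [rho^2]. *)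

Set Implicit Arguments.
Unset Strict Implicit.
Unset Printing Implicit Defensive.

Import Order.TTheory GRing.Theory Num.Theory.
Import numFieldNormedType.Exports.
Local Open Scope classical_set_scope.
Local Open Scope ring_scope.

(** * A smooth bump function *)

Section bump.
Context {R : realType}.
Implicit Types (P : {poly R}) (k : nat) (s a : R).

(** The exponential dominates each term of its series: [(theta * w) ^+ k / k!] is at most
    [expR (theta * w)]. *)
Lemma expR_pow_bounded k (theta : R) : 0 < theta ->
  exists2 C : R, 0 < C & forall w : R, 0 <= w -> w ^+ k * expR (- (theta * w)) <= C.
Proof.
move=> t0; exists (k`!%:R / theta ^+ k); first by rewrite divr_gt0 ?exprn_gt0// ltr0n fact_gt0.
move=> w w0; rewrite expRN ler_pdivrMr ?expR_gt0// mulrAC ler_pdivlMr ?exprn_gt0//.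
rewrite -exprMn (mulrC w) -ler_pdivrMl ?ltr0n ?fact_gt0//.
have tw0 : 0 <= theta * w by rewrite mulr_ge0// ltW.
case: k => [|k]; first by rewrite fact0 expr0 mulr1 invr1 -expR0 ler_expR.
by apply: le_trans (expR_ge1Dxn k tw0); rewrite [leLHS]mulrC lerDr.
Qed.

Lemma horner_bounded P :
  exists2 C : R, 0 < C & forall s, `|s| <= 1 -> `|P.[s]| <= C.
Proof.
(* The sum of the absolute coefficients bounds [P] on [-1, 1]; the added 1 keeps the constant
   positive when [P = 0]. *)
exists (1 + \sum_(i < size P) `|P`_i|); first by rewrite ltr_pwDl// sumr_ge0.
move=> s s1; rewrite horner_coef (le_trans (ler_norm_sum _ _ _))//.
apply: ler_wpDl => //; apply: ler_sum => i _.
by rewrite normrM ler_piMr// normrX exprn_ile1.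
Qed.

(* With [w = 1 / (1 - s^2)], the functions [P(s) w^k exp (- w)], extended by 0,
   form a family stable under differentiation. *)
Definition bump P k s : R :=
  if `|s| < 1 then P.[s] * (1 - s ^+ 2)^-1 ^+ k * expR (- (1 - s ^+ 2)^-1)
  else 0.

(** With v = 1 - s^2 and w = 1/v one has w' = 2 s w^2, so (P w^k exp(-w))' = (P' v^2 + 2 k s P v - 2
    s P) w^(k+2) exp(-w); this is the polynomial factor. *)
Definition bump_derive P k : {poly R} :=
  P^`() * (1 - 'X^2) ^+ 2 + (2 *+ k) *: ('X * P * (1 - 'X^2)) - 2 *: ('X * P).

Definition mollifier : R -> R := bump 1 0.

Lemma bump_out P k s : 1 <= `|s| -> bump P k s = 0.
Proof. by rewrite /bump ltNge => ->. Qed.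

Lemma sub1sqr_gt0 s : `|s| < 1 -> 0 < 1 - s ^+ 2.
Proof. by move=> s1; rewrite subr_gt0 -real_normK ?num_real// expr_lt1. Qed.

(** Split exp(-w) as exp(-(1 - r) w) exp(-r w): the first factor absorbs w^k by [expR_pow_bounded],
    the second is the power [r] of the mollifier. *)
Lemma bump_mollifier_le P k (r : R) : 0 < r < 1 ->
  exists2 C : R, 0 < C & forall s, `|bump P k s| <= C * mollifier s `^ r.
Proof.
move=> /andP[r0 r1].
have [M M0 PM] := horner_bounded P.
have [C C0 wC] := @expR_pow_bounded k (1 - r) ltac:(by rewrite subr_gt0).
exists (M * C); first exact: mulr_gt0.
move=> s; rewrite /mollifier /bump; case: ifPn => [s1|_]; last first.
  by rewrite normr0 powR0 ?mulr0// gt_eqF.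
have w0 : 0 <= (1 - s ^+ 2)^-1 by rewrite invr_ge0 ltW// sub1sqr_gt0.
rewrite hornerC expr0 !mul1r -expRM !normrM -mulrA.
rewrite -mulrA; apply: ler_pM => //; first exact/PM/ltW.
rewrite -normrM.
have := wC _ w0; set w := (1 - s ^+ 2)^-1 in w0 *.
rewrite ger0_norm; last by rewrite mulr_ge0 ?exprn_ge0 ?expR_ge0.
move=> /(ler_wpM2r (expR_ge0 (- w * r))); apply: le_trans.
by rewrite -mulrA -expRD le_eqVlt; apply/orP; left; apply/eqP; congr (_ * expR _); ring.
Qed.

(** Serves to differentiate at and beyond the endpoints. As 1 - s^2 = (1 - |s|)(1 + |s|) <= 2 |s -
    a|, two powers of 1 - s^2 can be traded for (s - a)^2, while w^(k+2) exp(-w) stays bounded. *)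
Lemma bump_quadratic P k a : 1 <= `|a| ->
  exists2 C : R, 0 < C & forall s, `|bump P k s| <= C * (s - a) ^+ 2.
Proof.
move=> a1; have [M M0 PM] := horner_bounded P.
have [C C0 wC] := @expR_pow_bounded k.+2 1 ltr01.
exists (M * C * 4); first by rewrite !mulr_gt0.
move=> s; rewrite /bump; case: ifPn => [s1|_]; last first.
  by rewrite normr0 mulr_ge0 ?sqr_ge0// !mulr_ge0// ltW.
have v0 := sub1sqr_gt0 s1.
have w0 : 0 <= (1 - s ^+ 2)^-1 by rewrite invr_ge0 ltW.
have vle : (1 - s ^+ 2) ^+ 2 <= 4 * (s - a) ^+ 2.
  have d0 : 0 <= 1 - `|s| by rewrite subr_ge0 ltW.
  have -> : 1 - s ^+ 2 = (1 - `|s|) * (1 + `|s|).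
    by rewrite -(real_normK (num_real s)); ring.
  rewrite exprMn mulrC ler_pM ?sqr_ge0//.
    rewrite (_ : 4 = 2 ^+ 2); last by rewrite -natrX.
    rewrite ler_pXn2r ?nnegrE ?addr_ge0//; lra.
  rewrite -(real_normK (num_real (s - a))) ler_pXn2r ?nnegrE//.
  by rewrite distrC (le_trans _ (lerB_dist _ _))// lerD2r.
rewrite !normrM -!mulrA; apply: ler_pM => //; first exact/PM/ltW.
rewrite -normrM.
rewrite ger0_norm; last by rewrite mulr_ge0 ?exprn_ge0 ?expR_ge0.
have := wC _ w0; rewrite mul1r.
move=> /(ler_wpM2r (sqr_ge0 (1 - s ^+ 2))) H.
apply: le_trans (le_trans H _).
  rewrite le_eqVlt -[k.+2]addn2 (exprD _ k); apply/orP; left; apply/eqP.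
  by set W := _ ^+ k; set e := expR _; field; rewrite gt_eqF.
by rewrite ler_wpM2l// ltW.
Qed.

Lemma quadratic_is_derive (f : R -> R) a C : f a = 0 ->
  (forall s, `|f s| <= C * (s - a) ^+ 2) -> is_derive a 1 f 0.
Proof.
move=> fa0 fC.
have C0 : 0 <= C.
  by have := fC (a + 1); rewrite addrAC subrr add0r expr1n mulr1; exact: le_trans.
suff H : h^-1 *: (f (h *: 1 + a) - f a) @[h --> 0^'] --> (0 : R).
  by apply: DeriveDef; [apply/cvg_ex; exists 0|exact/cvg_lim].
apply/cvgr0Pnorm_le => e e0; near=> h.
have h0 : h != 0 by near: h; exact: nbhs_dnbhs_neq.
rewrite fa0 subr0 normrM normfV ler_pdivrMl ?normr_gt0//.
apply: le_trans (fC _) _.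
rewrite /GRing.scale/= mulr1 addrK -real_normK ?num_real// expr2 mulrA mulrC.
rewrite ler_wpM2l//.
(* Dividing by [C + 1] rather than [C] covers [C = 0]. *)
have : `|h| <= e / (C + 1).
  by near: h; apply: dnbhs0_le; rewrite divr_gt0// ltr_wpDl//.
move=> /(ler_wpM2l C0) /le_trans; apply.
rewrite mulrCA ler_piMr ?(ltW e0)//.
by rewrite ler_pdivrMr ?ltr_wpDl// mul1r lerDl.
Unshelve. all: by end_near. Qed.

(** Inside (-1, 1) this is the product rule; for |s| >= 1, endpoints included, the quadratic bound
    forces the derivative to be 0. *)
Lemma is_derive_bump P k s :
  is_derive s 1 (bump P k) (bump (bump_derive P k) k.+2 s).
Proof.
have [s1|s1] := ltP `|s| 1; last first.
  rewrite [bump (_ _ _) _ _]bump_out//.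
  have [C _ HC] := bump_quadratic P k s1.
  exact: quadratic_is_derive (bump_out _ _ s1) HC.
have v0 := sub1sqr_gt0 s1.
pose f (x : R) := P.[x] * (1 - x ^+ 2)^-1 ^+ k * expR (- (1 - x ^+ 2)^-1).
apply: (@near_eq_is_derive _ _ _ f).
  near=> x; rewrite /bump ifT//; near: x.
  have : {for s, continuous (fun x : R => `|x|)} by exact: norm_continuous.
  by move/cvgr_lt; apply.
rewrite /bump s1 /f.
set v := 1 - s ^+ 2 in v0 *.
have dv : is_derive s 1 (fun x : R => 1 - x ^+ 2) (- (2 * s)).
  by apply: trigger_derive; rewrite /GRing.scale/=; ring.
have dw : is_derive s 1 (fun x : R => (1 - x ^+ 2)^-1) (2 * s * v ^- 2).
  have [dv1 dv2] := dv; have vn := lt0r_neq0 v0.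
  apply: DeriveDef; first exact: derivableV.
  by rewrite deriveV// dv2 -/v /GRing.scale/=; ring.
have dwk : is_derive s 1 (fun x : R => (1 - x ^+ 2)^-1 ^+ k)
    (k%:R * v^-1 ^+ k.-1 * (2 * s * v ^- 2)).
  rewrite (_ : (fun x : R => _) = (fun x : R => (1 - x ^+ 2)^-1 : R) ^+ k).
    exact: is_deriveX.
  by apply/funext => x; rewrite exprfctE.
have de : is_derive s 1 (fun x : R => expR (- (1 - x ^+ 2)^-1))
    (- (2 * s * v ^- 2) * expR (- v^-1)).
  have := @is_derive1_comp _ expR (fun x => - (1 - x ^+ 2)^-1) s _ _
     (is_derive_expR _) (@is_deriveN _ _ _ _ _ _ _ dw).
  by move=> H; apply: trigger_derive H _; rewrite mulrC.
have d1 : is_derive s 1 (fun x : R => P.[x] * (1 - x ^+ 2)^-1 ^+ k)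
    (P.[s] * (k%:R * v^-1 ^+ k.-1 * (2 * s * v ^- 2)) + v^-1 ^+ k * P^`().[s]).
  exact: (is_deriveM (is_derive_poly P s) dwk).
apply: (trigger_derive (is_deriveM d1 de)).
rewrite -[RHS]/(_ * v^-1 ^+ k.+2 * expR (- v^-1)).
have -> : (bump_derive P k).[s] = P^`().[s] * v ^+ 2 +
    2 * k%:R * (s * P.[s] * v) - 2 * (s * P.[s]).
  by rewrite /bump_derive !hornerE -/v mulr_natr; ring.
rewrite -[LHS]/(P.[s] * v^-1 ^+ k * (- (2 * s * v ^- 2) * expR (- v^-1)) +
  expR (- v^-1) * (P.[s] * (k%:R * v^-1 ^+ k.-1 * (2 * s * v ^- 2)) +
    v^-1 ^+ k * P^`().[s])).
have vn : v != 0 by rewrite gt_eqF.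
(* The exponent [k.-1] truncates at [k = 0], where its coefficient [k%:R] vanishes, so this case is
   treated apart. *)
case: k {f dwk d1} => [|k]; first by rewrite !expr0; field.
rewrite succnK -[k.+3]addn3 (exprD _ k) (exprS _ k).
by set W := _ ^+ k; field.
Unshelve. all: by end_near. Qed.

End bump.

(** * Bounds and derivatives of the scaled mollifier *)

Section mollifier.
Context {R : realType}.
Implicit Types (P : {poly R}) (k : nat) (s a : R).

Lemma mollifier_ge0 s : 0 <= mollifier s.
Proof.
rewrite /mollifier /bump; case: ifP => // _.
by rewrite hornerC expr0 !mul1r expR_ge0.
Qed.

Lemma mollifier_le1 s : mollifier s <= 1.
Proof.
rewrite /mollifier /bump; case: ifP => // s1.
rewrite hornerC expr0 !mul1r -[leRHS]expR0 ler_expR oppr_le0 invr_ge0 ltW//.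
exact: sub1sqr_gt0.
Qed.

Lemma mollifier_out s : mollifier s != 0 -> `|s| < 1.
Proof. by rewrite /mollifier /bump; case: ifP; rewrite ?eqxx. Qed.

Lemma mollifier_half s : `|s| <= 2^-1 -> expR (- 2) <= mollifier s.
Proof.
move=> s2; rewrite /mollifier /bump ifT; last by lra.
rewrite hornerC expr0 !mul1r ler_expR lerN2.
have : s ^+ 2 <= 2^-1.
  rewrite -real_normK ?num_real// expr2 -[leRHS]mul1r.
  by rewrite ler_pM//; lra.
by move=> h; rewrite invf_ple ?posrE//; lra.
Qed.

Lemma mollifier_le_powR s (r : R) : 0 < r <= 1 -> mollifier s <= mollifier s `^ r.
Proof.
move=> /andP[r0 r1]; have := mollifier_ge0 s; rewrite le_eqVlt => /predU1P[<-|b0].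
  exact: powR_ge0.
by rewrite ger1_powR// b0 mollifier_le1.
Qed.

Lemma bumpZ (c : R) P k s : bump (c *: P) k s = c * bump P k s.
Proof. by rewrite /bump; case: ifP; rewrite ?mulr0// hornerZ !mulrA. Qed.

Lemma is_derive_bump_scale P k a s :
  is_derive s 1 (fun x : R => bump P k (a * x))
    (bump (a *: bump_derive P k) k.+2 (a * s)).
Proof.
rewrite bumpZ mulrC.
have da : is_derive s 1 (fun x : R => a * x) a.
  by apply: trigger_derive; rewrite /GRing.scale/= mulr1.
exact: (@is_derive1_comp _ (bump P k) (fun x : R => a * x) s _ _
  (is_derive_bump P k (a * s)) da).
Qed.

Lemma derive1_bump_scale P k a :
  derive1 (fun x : R => bump P k (a * x)) =
  (fun x => bump (a *: bump_derive P k) k.+2 (a * x)).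
Proof.
by apply/funext => s; rewrite derive1E; have [_ ->] := is_derive_bump_scale P k a s.
Qed.

Lemma derive1n_bump_scale j a P k : exists P' k',
  derive1n j (fun x : R => bump P k (a * x)) = (fun x => bump P' k' (a * x)).
Proof.
elim: j => [|j [P' [k' ih]]]; first by exists P, k.
by rewrite derive1nS ih derive1_bump_scale; do 2 eexists.
Qed.

Lemma mollifier_time_test T (S : R) : 0 < S -> (S%:E < T)%E ->
  time_test_function T (fun t => mollifier (S^-1 * t)).
Proof.
move=> S0 ST; split=> [j t|].
  have [P [k ->]] := derive1n_bump_scale j S^-1 1 0.
  by have [] := is_derive_bump_scale P k S^-1 t.
(* Only values on [0, T) count, so [0, S] serves as support although the mollifier is also nonzero
   at negative times. *)
exists `[0, S]%classic; first exact: segment_compact.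
split=> [t|t [t0 _] /mollifier_out].
  rewrite /= in_itv/= => /andP[t0 tS]; split => //.
  by apply: le_lt_trans ST; rewrite lee_fin.
rewrite normrM gtr0_norm ?invr_gt0// ltr_pdivrMl// mulr1 => /ltW.
by rewrite /= in_itv/= t0/=; apply: le_trans; exact: ler_norm.
Qed.

(** The polynomial [bump_derive 1 0] is -2X, which vanishes at 0. This will remove the data term
    containing [u0] alone. *)
Lemma derive1_mollifier0 a : derive1 (fun t => mollifier (a * t)) 0 = 0.
Proof.
rewrite derive1_bump_scale mulr0 bumpZ /bump normr0 ltr01 /bump_derive.
by rewrite derivC !hornerE /= !(mulr0, mul0r, oppr0).
Qed.

(** Both derivatives are bumps again, hence controlled by [bump_mollifier_le]; each differentiation
    brings out one factor [a]. *)
Lemma mollifier_deriv_le (r : R) : 0 < r < 1 ->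
  exists2 C : R, 0 < C & forall a t,
   `|derive1 (fun t => mollifier (a * t)) t| <= `|a| * C * mollifier (a * t) `^ r /\
   `|derive1n 2 (fun t => mollifier (a * t)) t| <= a ^+ 2 * C * mollifier (a * t) `^ r.
Proof.
move=> r01.
have [C1 C10 H1] := bump_mollifier_le (bump_derive 1 0) 2 r01.
have [C2 C20 H2] := bump_mollifier_le (bump_derive (bump_derive 1 0) 2) 4 r01.
exists (C1 + C2); first exact: addr_gt0.
move=> a t; split.
  rewrite derive1_bump_scale bumpZ normrM -mulrA ler_wpM2l//.
  by apply: le_trans (H1 _) _; rewrite ler_wpM2r ?powR_ge0// lerDl ltW.
rewrite -[derive1n 2 _]/(derive1 (derive1 _)) derive1_bump_scale derive1_bump_scale bumpZ.
have -> : bump_derive (a *: bump_derive (1 : {poly R}) 0) 2 =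
    a *: bump_derive (bump_derive 1 0) 2.
  rewrite [LHS]/bump_derive [in RHS]/bump_derive derivZ.
  by rewrite -!scalerAl -!scalerAr -!scalerAl !scalerDr !scalerN !scalerA (mulrC 2) [a * _]mulrC.
rewrite bumpZ mulrA normrM -expr2 normrX real_normK ?num_real// -mulrA ler_wpM2l ?sqr_ge0//.
by apply: le_trans (H2 _) _; rewrite ler_wpM2r ?powR_ge0// lerDr ltW.
Qed.

End mollifier.

(** * Products of functions of one coordinate *)

Section prod_coord.
Context {R : realType} {n : nat}.
Implicit Types (f : 'I_n -> R -> R) (x : 'rV[R]_n).

Definition prod_coord f x : R := \prod_(i < n) f i (x ord0 i).

(** Moving along the [j]-th basis vector changes only the [j]-th factor, so the difference quotient
    is that of [f j] times a constant. *)
Lemma is_derive_prod_coord f x j (d : R) : is_derive (x ord0 j) 1 (f j) d ->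
  is_derive x (delta_mx ord0 j) (prod_coord f)
    (d * \prod_(i < n | i != j) f i (x ord0 i)).
Proof.
move=> [df <-]; set Q := \prod_(_ | _) _.
have E : (fun h : R => h^-1 *: (prod_coord f (h *: delta_mx ord0 j + x) - prod_coord f x))
    = (fun h : R => h^-1 *: (f j (h *: 1 + x ord0 j) - f j (x ord0 j)) * Q).
  apply/funext => h; rewrite /prod_coord (bigD1 j)//= [in X in _ - X](bigD1 j)//=.
  rewrite !mxE !eqxx /GRing.scale/= -/Q.
  rewrite (eq_bigr (fun i => f i (x ord0 i))); last first.
    by move=> i /negbTE ij; rewrite !mxE eqxx ij/= mulr0 add0r.
  by rewrite -mulrBl mulrA.
have L : h^-1 *: (prod_coord f (h *: delta_mx ord0 j + x) - prod_coord f x)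
    @[h --> 0^'] --> 'D_1 (f j) (x ord0 j) * Q.
  by rewrite E; apply: cvgMl; exact: df.
by apply: DeriveDef; [apply/cvg_ex; eexists; exact: L|exact/cvg_lim].
Qed.

Lemma continuous_prod_coord f : (forall i, continuous (f i)) ->
  continuous (prod_coord f).
Proof.
move=> cf x; rewrite /prod_coord; elim: (index_enum _) => [|i s ih].
  under eq_fun do rewrite big_nil.
  exact: cst_continuous.
under eq_fun do rewrite big_cons.
apply: (continuousM (s := fun y : 'rV[R]_n => f i (y ord0 i))) => //.
apply: (continuous_comp (f := fun y : 'rV[R]_n => y ord0 i)).
  exact: coord_continuous.
exact: cf.
Qed.

End prod_coord.

(** * The cutoff in space and its Laplacian *)

Section cutoff.
Context {R : realType} {n : nat}.
Implicit Types (x : 'rV[R]_n) (P : 'I_n -> {poly R}) (k : 'I_n -> nat) (a : R).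

(** A family containing [cutoff] and stable under partial derivatives: direction [j] alters only
    [P j] and [k j]. Smoothness follows by induction on the list of directions. *)
Let pbump P k a : 'rV[R]_n -> R := prod_coord (fun i s => bump (P i) (k i) (a * s)).

Definition cutoff a : 'rV[R]_n -> R := prod_coord (fun _ s => mollifier (a * s)).

Lemma is_derive_pbump P k a x j :
  is_derive x (delta_mx ord0 j) (pbump P k a)
   (pbump (fun i => if i == j then a *: bump_derive (P j) (k j) else P i)
      (fun i => if i == j then (k j).+2 else k i) a x).
Proof.
rewrite [X in is_derive _ _ _ X](_ : _ =
  bump (a *: bump_derive (P j) (k j)) (k j).+2 (a * x ord0 j) *
   \prod_(i < n | i != j) bump (P i) (k i) (a * x ord0 i)).
  apply: (is_derive_prod_coord (f := fun i s => bump (P i) (k i) (a * s))).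
  exact: is_derive_bump_scale.
rewrite /pbump /prod_coord (bigD1 j)//= eqxx; congr (_ * _).
by apply: eq_bigr => i /negbTE ->.
Qed.

Lemma partials_pbump s P k a : exists P' k', partials s (pbump P k a) = pbump P' k' a.
Proof.
elim: s => [|j s [P' [k' ih]]]; first by exists P, k.
rewrite /partials/= -/(partials s _) ih; do 2 eexists; apply/funext => x.
by rewrite /partial; have [_ ->] := is_derive_pbump P' k' a x j.
Qed.

Lemma smooth_cutoff a : smooth (cutoff a).
Proof.
move=> s; have [P [k E]] := partials_pbump s (fun=> 1) (fun=> 0%N) a.
rewrite -[cutoff a]/(pbump (fun=> 1) (fun=> 0%N) a) E; split.
  apply: continuous_prod_coord => i t.
  have [dt _] := is_derive_bump_scale (P i) (k i) a t.
  exact/differentiable_continuous/derivable1_diffP.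
by move=> i x; have [] := is_derive_pbump P k a x i.
Qed.

Lemma cutoff_ge0 a x : 0 <= cutoff a x.
Proof. by apply: prodr_ge0 => i _; exact: mollifier_ge0. Qed.

Lemma cutoff_le1 a x : cutoff a x <= 1.
Proof. by apply: prodr_ile1 => i _; rewrite mollifier_ge0 mollifier_le1. Qed.

Lemma cutoff_neq0 a x i : cutoff a x != 0 -> `|a * x ord0 i| < 1.
Proof.
rewrite /cutoff /prod_coord (bigD1 i)//= mulf_eq0 negb_or => /andP[+ _].
exact: mollifier_out.
Qed.

Lemma test_function_cutoff a : 0 < a -> test_function (cutoff a).
Proof.
move=> a0; split; first exact: smooth_cutoff.
pose K := [set x : 'rV[R]_n | forall i, `[- a^-1, a^-1]%classic (x ord0 i)].
have cK : compact K.
  apply: (@rV_compact _ _ (fun=> `[- a^-1, a^-1]%classic)) => i.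
  exact: segment_compact.
apply: (subclosed_compact _ cK); first exact: closed_closure.
have -> : K = closure K.
  by apply/closure_id; apply: compact_closed cK; exact: norm_hausdorff.
apply: closureS => x /= hx i; rewrite /= in_itv/= -ler_norml.
have := cutoff_neq0 i hx; rewrite normrM gtr0_norm// -ltr_pdivlMl// mulr1.
exact: ltW.
Qed.

Lemma cutoff_powR a x (r : R) :
  cutoff a x `^ r = \prod_(i < n) mollifier (a * x ord0 i) `^ r.
Proof.
rewrite /cutoff /prod_coord.
suff [] : (\prod_(i < n) mollifier (a * x ord0 i)) `^ r =
   \prod_(i < n) mollifier (a * x ord0 i) `^ r /\
  0 <= \prod_(i < n) mollifier (a * x ord0 i) by [].
elim/big_rec2 : _ => [|i y1 y2 _ [<- y0]]; first by rewrite powR1.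
by rewrite powRM ?mollifier_ge0// mulr_ge0// mollifier_ge0.
Qed.

(** A pure second derivative falls on one factor, bounded by [mollifier_deriv_le]; the other factors
    lie in [0, 1] and so are at most their own power [r]. *)
Lemma laplacian_cutoff_le (r : R) : 0 < r < 1 ->
  exists2 C : R, 0 < C & forall a x,
    `|laplacian (cutoff a) x| <= a ^+ 2 * C * cutoff a x `^ r.
Proof.
move=> /[dup] r01 /andP[r0 r1].
have [C C0 H] := mollifier_deriv_le r01.
(* There are [n] summands; [n.+1] keeps the constant positive in dimension 0. *)
exists (n.+1%:R * C); first by rewrite mulr_gt0// ltr0n.
move=> a x; rewrite /laplacian (le_trans (ler_norm_sum _ _ _))//.
suff h i : `|partials [:: i; i] (cutoff a) x| <= a ^+ 2 * C * cutoff a x `^ r.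
  apply: (@le_trans _ _ (\sum_(i < n) (a ^+ 2 * C * cutoff a x `^ r))).
    by apply: ler_sum => i _; exact: h.
  rewrite sumr_const card_ord -[leLHS]mulr_natl.
  rewrite [leLHS](_ : _ = a ^+ 2 * (n%:R * C) * cutoff a x `^ r); last by ring.
  rewrite ler_wpM2r ?powR_ge0// ler_wpM2l ?sqr_ge0//.
  by apply: ler_wpM2r; [exact: ltW|rewrite ler_nat].
pose m (t : R) := mollifier (a * t).
pose F : 'I_n -> R -> R := fun j => if j == i then derive1 m else m.
have dm (t : R) : is_derive t (1 : R) m (derive1 m t).
  by have [dt _] := is_derive_bump_scale 1 0 a t; apply: DeriveDef => //; rewrite derive1E.
have dm2 (t : R) : is_derive t (1 : R) (derive1 m) (derive1n 2 m t).
  apply: DeriveDef; last by rewrite -[RHS]/(derive1 (derive1 m) t) [RHS]derive1E.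
  by rewrite derive1_bump_scale; have [] := is_derive_bump_scale (a *: bump_derive 1 0) 2 a t.
have E1 : partial i (cutoff a) = prod_coord F.
  apply/funext => y; rewrite /partial.
  have [_ ->] := is_derive_prod_coord (f := fun=> m) (dm (y ord0 i)).
  rewrite /prod_coord [RHS](bigD1 i)//= /F eqxx; congr (_ * _).
  by apply: eq_bigr => j /negbTE ->.
have dF : is_derive (x ord0 i) 1 (F i) (derive1n 2 m (x ord0 i)).
  by rewrite /F eqxx.
rewrite /partials/= E1 /partial; have [_ ->] := is_derive_prod_coord dF.
rewrite normrM cutoff_powR [in leRHS](bigD1 i)//= [leRHS]mulrA.
apply: ler_pM => //; first by have [] := H a (x ord0 i).
rewrite normr_prod; apply: ler_prod => j ji; rewrite normr_ge0 /F (negbTE ji)/=.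
by rewrite ger0_norm ?mollifier_ge0// mollifier_le_powR// r0 ltW.
Qed.

End cutoff.

(** * Integration *)

Section integral_le.
Context d (T : measurableType d) {R : realType}.
Variable mu : {measure set T -> \bar R}.
Implicit Types (D : set T) (f g : T -> \bar R).
Local Open Scope ereal_scope.

(* Measurability is not available where this is used: the weak formulation only
   makes the nonlinear term measurable in space for almost every time. *)
Lemma le_integral_ge0 D f g : (forall x, D x -> 0 <= g x) ->
  (forall x, D x -> f x <= g x) ->
  \int[mu]_(x in D) f x <= \int[mu]_(x in D) g x.
Proof.
move=> g0 fg; rewrite integralE; apply: (@le_trans _ _ (\int[mu]_(x in D) f^\+ x)).
  by rewrite geeDl// oppe_le0 integral_ge0.
(* Both sides are now suprema over simple functions, and a simple function below the positive part
   of [f] is below [g]. *)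
rewrite ge0_integralE// [leRHS]ge0_integralE//; apply: le_ereal_sup => _ /= [h hf <-].
exists h => //= x; apply: le_trans (hf x) _; rewrite !patchE; case: ifPn => //.
by rewrite inE => Dx; rewrite funeposE ge_max fg ?g0.
Qed.

End integral_le.

(** * Finiteness and positivity of the Gamma integral *)

Section Gamma.
Context {R : realType}.
Notation leb := (@lebesgue_measure R).
Implicit Types (s t : R).

(* [g s] is the derivative of [G s], which is bounded, and it dominates the
   integrand of [Gamma s] up to a constant. *)
Let G s t : R := - (1 + t `^ s)^-1.
Let g s t : R := s * t `^ (s - 1) / (1 + t `^ s) ^+ 2.

Let is_derive_powR s t : 0 < t -> is_derive t 1 (fun x : R => x `^ s) (s * t `^ (s - 1)).
Proof.
move=> t0; have t0' : t \in `]0, +oo[ by rewrite in_itv/= t0.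
apply: DeriveDef; first exact: derivable_powR.
by rewrite -(powR_derive1 s t0') derive1E.
Qed.

Let is_derive_G s t : 0 < t -> is_derive t 1 (G s) (g s t).
Proof.
move=> t0; have dp := is_derive_powR s t0.
have d1 : is_derive t 1 (fun x : R => 1 + x `^ s) (s * t `^ (s - 1)).
  have := is_deriveD (is_derive_cst (1 : R) t 1) dp; rewrite add0r; exact.
have n0 : 1 + t `^ s != 0 by rewrite gt_eqF// ltr_wpDr// powR_ge0.
have := is_deriveN (@is_deriveV _ (fun x : R => 1 + x `^ s) t _ 1 n0 d1) => h; apply: trigger_derive h _.
by rewrite /g /GRing.scale/=; field.
Qed.

Let derivable_g s t : 0 < t -> derivable (g s) t 1.
Proof.
move=> t0; have [dp _] := is_derive_powR s t0.
have [dp1 _] := is_derive_powR (s - 1) t0.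
apply: derivableM.
  apply: derivableM => //; exact: derivable_cst.
apply: (derivableV (f := fun x : R => (1 + x `^ s) ^+ 2)).
  by rewrite expf_neq0// gt_eqF// ltr_wpDr// powR_ge0.
rewrite (_ : (fun x : R => _) = (fun x : R => 1 + x `^ s) ^+ 2); last first.
  by apply/funext => x; rewrite exprfctE.
by apply: derivableX; apply: derivableD => //; exact: derivable_cst.
Qed.

Let integral_g_le1 s (a b : R) : 0 < s -> 0 < a -> a < b ->
  (\int[leb]_(t in `[a, b]) (g s t)%:E <= 1)%E.
Proof.
move=> s0 a0 ab.
rewrite (@continuous_FTC2 _ (g s) (G s))//.
- rewrite -EFinB lee_fin /G opprK addrC lerBlDr.
  apply: (@le_trans _ _ 1).
    by rewrite invf_le1 ?lerDl ?powR_ge0// ltr_wpDr// powR_ge0.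
  by rewrite lerDl invr_ge0 addr_ge0// powR_ge0.
- apply: derivable_within_continuous => x; rewrite in_itv/= => /andP[ax _].
  exact/derivable_g/(lt_le_trans a0).
- have cG x : 0 < x -> {for x, continuous (G s)}.
    move=> x0; have [dG _] := is_derive_G s x0.
    exact/differentiable_continuous/derivable1_diffP.
  split.
  + move=> x; rewrite in_itv/= => /andP[ax _].
    by have [] := is_derive_G s (lt_trans a0 ax).
  + exact/cvg_at_right_filter/cG.
  + exact/cvg_at_left_filter/cG/(lt_trans a0).
- move=> x; rewrite in_itv/= => /andP[ax _].
  by rewrite derive1E; have [_ ->] := is_derive_G s (lt_trans a0 ax).
Qed.

Let Gamma_integrand_le s : 0 < s -> exists2 C : R, 0 < C &
  forall t, 0 < t -> t `^ (s - 1) * expR (- t) <= C * g s t.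
Proof.
(* A natural number above [s] reduces real powers of [t] to the integer powers of
   [expR_pow_bounded]. *)
move=> s0; pose m := (Num.truncn s).+1.
have sm : s <= m%:R by rewrite ltW// truncnS_gt.
have [C C0 HC] := @expR_pow_bounded R (m + m) 1 ltr01.
exists ((8 + 2 * C) / s); first by rewrite divr_gt0// ltr_pwDl// mulr_ge0// ltW.
move=> t t0; have p0 : 0 < 1 + t `^ s by rewrite ltr_wpDr// powR_ge0.
rewrite /g [leRHS](_ : _ = t `^ (s - 1) * ((8 + 2 * C) / (1 + t `^ s) ^+ 2)); last first.
  by field; rewrite !gt_eqF.
rewrite ler_wpM2l ?powR_ge0// ler_pdivlMr ?exprn_gt0//.
have ts : t `^ s <= 1 + t ^+ m.
  have [t1|t1] := leP t 1.
    rewrite -[leLHS]addr0 lerD ?exprn_ge0 ?(ltW t0)//.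
    by have := ge0_ler_powR (ltW s0) (ltW t0 : t \in Num.nneg) (ler01 : 1 \in Num.nneg) t1; rewrite powR1.
  rewrite -powR_mulrn ?(ltW t0)// (le_trans (ler_powR (ltW t1) sm))//.
  by rewrite lerDr.
have ex1 : expR (- t) <= 1 by rewrite -[leRHS]expR0 ler_expR oppr_le0 ltW.
have := HC t (ltW t0); rewrite mul1r exprD.
set u := t ^+ m; set e := expR (- t) => He.
have u0 : 0 <= u by rewrite exprn_ge0// ltW.
have e0 : 0 <= e by exact: expR_ge0.
rewrite -/u in ts.
apply: (@le_trans _ _ (e * (2 + u) ^+ 2)).
  rewrite ler_wpM2l// ler_pXn2r ?nnegrE ?(ltW p0)//; lra.
have : 0 <= (2 - u) ^+ 2 by exact: sqr_ge0.
move=> /(mulr_ge0 e0) v0.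
(* The identity (2 + u)^2 = 8 + 2 u^2 - (2 - u)^2 is the origin of the constant [8 + 2 * C]. *)
rewrite [X in X <= _](_ : _ = 8 * e + 2 * (u * u * e) - e * (2 - u) ^+ 2); last by ring.
rewrite -/e in ex1; lra.
Qed.

Let Gamma_integral s := (\int[leb]_(t in `]0%R, +oo[) (t `^ (s - 1) * expR (- t))%:E)%E.

Let measurable_integrand s (D : set R) :
  measurable_fun D (fun t : R => t `^ (s - 1) * expR (- t)).
Proof.
apply: (@measurable_funS _ _ _ _ setT) => //; apply: measurable_funM.
  exact: measurable_powR.
by apply: measurableT_comp; [exact: measurable_expR|exact: oppr_measurable].
Qed.

Let Gamma_integral_lty s : 0 < s -> (Gamma_integral s < +oo)%E.
Proof.
move=> s0; have [C C0 HC] := Gamma_integrand_le s0.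
(* Compact intervals exhausting the half-line; [k.+2] makes each one nondegenerate. On each, the
   integral is at most [C], and monotone convergence passes to the union. *)
pose F (k : nat) : set R := `[k.+2%:R^-1, k.+2%:R]%classic.
have F0 k t : F k t -> 0 < t.
  by rewrite /F/= in_itv/= => /andP[+ _]; apply: lt_le_trans; rewrite invr_gt0.
have UF : \bigcup_k F k = `]0, +oo[%classic.
  apply/seteqP; split => t /=; first by case=> k _ /F0 t0; rewrite in_itv/= t0.
  rewrite in_itv/= andbT => t0.
  exists (maxn (Num.truncn t) (Num.truncn t^-1)) => //; rewrite /F/= in_itv/=.
  set N := maxn _ _; apply/andP; split.
    rewrite invf_ple ?posrE// ltW// (lt_le_trans (truncnS_gt _))// ler_nat.
    by rewrite ltnS (leq_trans (leq_maxr (Num.truncn t) _))// leqnSn.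
  rewrite ltW// (lt_le_trans (truncnS_gt _))// ler_nat.
  by rewrite ltnS (leq_trans (leq_maxl _ (Num.truncn t^-1)))// leqnSn.
apply: (@le_lt_trans _ _ C%:E); last exact: ltry.
rewrite /Gamma_integral -UF.
have ndF : nondecreasing_seq F.
  move=> i j ij; rewrite subsetEset => t; rewrite /F/= !in_itv/= => /andP[a b].
  rewrite (le_trans _ a) ?(le_trans b) ?ler_nat ?ltnS//.
  by rewrite lef_pV2 ?posrE ?ler_nat ?ltnS.
have mF k : measurable (F k) by exact: measurable_itv.
have mf k : measurable_fun (F k) (fun t => (t `^ (s - 1) * expR (- t))%:E).
  by apply/measurable_EFinP; apply: (measurable_integrand s).
have f0 t : (0 <= (t `^ (s - 1) * expR (- t))%:E)%E.
  by rewrite lee_fin mulr_ge0 ?powR_ge0 ?expR_ge0.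
have H : (\int[leb]_(t in F k) (t `^ (s - 1) * expR (- t))%:E @[k --> \oo] -->
    \int[leb]_(t in \bigcup_k F k) (t `^ (s - 1) * expR (- t))%:E)%E.
  by apply: ge0_nondecreasing_set_cvg_integral => // i x _; exact: f0.
rewrite -(cvg_lim _ H)//; apply: lime_le; first exact: cvgP H.
apply: nearW => k.
apply: (@le_trans _ _ (\int[leb]_(t in F k) (C%:E * (g s t)%:E))%E).
  apply: le_integral_ge0 => t /F0 t0; rewrite -EFinM.
    by apply: le_trans (f0 t) _; rewrite lee_fin HC.
  by rewrite lee_fin HC.
have mg : measurable_fun (F k) (g s).
  apply: subspace_continuous_measurable_fun => //.
  by apply: derivable_within_continuous => t /F0; exact: derivable_g.
have g0 t : F k t -> (0 <= (g s t)%:E)%E.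
  move=> /F0 t0; rewrite lee_fin /g divr_ge0 ?exprn_ge0 ?addr_ge0 ?powR_ge0//.
  by rewrite mulr_ge0 ?powR_ge0// ltW.
have mgE : measurable_fun (F k) (fun t => (g s t)%:E) by exact/measurable_EFinP.
have C0' : (0 <= C%:E)%E by rewrite lee_fin ltW.
rewrite (ge0_integralZl leb (mF k) mgE g0 C0').
rewrite -[leRHS]mule1 lee_wpmul2l ?lee_fin ?(ltW C0)//.
apply: integral_g_le1 => //.
by rewrite (@lt_trans _ _ 1) ?invf_lt1 ?ltr1n.
Qed.

(** [Rintegral] sends an infinite integral to 0, so finiteness is required as well. The lower bound
    comes from [1, 2], where t^(s-1) >= exp(-|s - 1| ln 2) and exp(-t) >= exp(-2). *)
Lemma Gamma_gt0 s : 0 < s -> 0 < Gamma s.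
Proof.
move=> s0; rewrite /Gamma /Rintegral.
have int0 : (0 <= Gamma_integral s)%E.
  by apply: integral_ge0 => t _; rewrite lee_fin mulr_ge0 ?powR_ge0 ?expR_ge0.
apply: fine_gt0; rewrite -/(Gamma_integral s) Gamma_integral_lty// andbT.
pose m : R := expR (- `|s - 1| * ln 2) * expR (- 2).
have m0 : 0 < m by rewrite mulr_gt0 ?expR_gt0.
apply: (@lt_le_trans _ _ (m%:E * leb `[1%R, 2%R])%E).
  rewrite lebesgue_measure_itv/= lte_fin ifT; last by lra.
  by rewrite -EFinB -EFinM lte_fin mulr_gt0//; lra.
rewrite -integral_cst//; apply: (@le_trans _ _
    (\int[leb]_(t in `[1%R, 2%R]) (t `^ (s - 1) * expR (- t))%:E)%E).
  apply: le_integral_ge0 => t; rewrite /= in_itv/= => /andP[t1 t2].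
    by rewrite lee_fin mulr_ge0 ?powR_ge0 ?expR_ge0.
  rewrite lee_fin ler_pM ?expR_ge0// ?ler_expR ?lerN2//.
  rewrite /powR gt_eqF ?(lt_le_trans ltr01)// ler_expR.
  have : ln t <= ln 2 by rewrite ler_ln ?posrE// (lt_le_trans ltr01).
  have : 0 <= ln t by exact: ln_ge0.
  have := ler_norm (s - 1); have := ler_norm (- (s - 1)); rewrite normrN.
  nra.
apply: ge0_subset_integral => //.
- by apply/measurable_EFinP; apply: (measurable_integrand s).
- by move=> t _; rewrite lee_fin mulr_ge0 ?powR_ge0 ?expR_ge0.
- by move=> t; rewrite /= !in_itv/= andbT => /andP[t1 _]; lra.
Qed.

End Gamma.

(** * Cubes, points and the Euclidean norm in R^n *)

Section rV_measure.
Context {R : realType}.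
Implicit Types (n : nat) (L : R).

Definition cube n L : set 'rV[R]_n := [set x | forall i, `|x ord0 i| <= L].

Lemma measurable_coord n (i : 'I_n) : measurable_fun [set: 'rV[R]_n] (fun x => x ord0 i).
Proof. exact: measurable_rV_coord. Qed.

Lemma measurable_cube n L : measurable (@cube n L).
Proof.
rewrite (_ : cube L = \bigcap_(i in [set: 'I_n]) [set x | `|x ord0 i| <= L]); last first.
  by apply/seteqP; split => x /= h i => [_|]; exact: h.
apply: fin_bigcap_measurable; first exact: finite_finset.
move=> i _; have := measurable_coord i measurableT (measurable_itv `[- L, L]).
rewrite setTI; congr measurable.
by apply/seteqP; split => x /=; rewrite in_itv/= ler_norml.
Qed.

(** Induction on the dimension: the preimage of a cube under [rV_cons] is an interval times a
    cube. *)
Lemma lebesgue_cube n L : 0 <= L -> lebesgue_rV R n (cube L) = ((2 * L) ^+ n)%:E.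
Proof.
move=> L0; elim: n => [|n ih].
  rewrite /= expr0 diracE mem_set// => i; by case: i.
rewrite /= /rV_cons_measure /pushforward.
rewrite (_ : @rV_cons R n @^-1` cube L = `[- L, L]%classic `*` cube L); last first.
  apply/seteqP; split => -[a x]; rewrite /rV_cons /cube /= in_itv/= -ler_norml.
    move=> h; split; first by have := h ord0; rewrite mxE unlift_none.
    by move=> i; have := h (lift ord0 i); rewrite mxE liftK.
  by move=> [h1 h2] i; rewrite mxE; case: unliftP => [j _|_] /=.
rewrite product_measure1E//; last exact: measurable_cube.
rewrite exprS EFinM; congr (_ * _)%E; last exact: ih.
suff : lebesgue_measure `[- L, L]%classic = (2 * L)%:E by [].
rewrite lebesgue_measure_itv/= lte_fin.
have [L1|L1] := ltP (- L) L; first by rewrite -EFinB; congr EFin; ring.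
by congr EFin; lra.
Qed.

Lemma measurable_rV_set1 n (x : 'rV[R]_n) : measurable [set x].
Proof.
rewrite (_ : [set x] = \bigcap_(i in [set: 'I_n]) [set y : 'rV[R]_n | y ord0 i = x ord0 i]).
  apply: fin_bigcap_measurable; first exact: finite_finset.
  move=> i _; have := measurable_coord i measurableT (measurable_set1 (x ord0 i)).
  by rewrite setTI.
apply/seteqP; split => [y /= -> i _//|y h] /=.
by apply/rowP => i; exact: h.
Qed.

(** The dimension has to be positive, since the point of R^0 has mass 1. Needed to discard the
    singularity of the Riesz kernel. *)
Lemma lebesgue_rV_set1 n (x : 'rV[R]_n.+1) : lebesgue_rV R n.+1 [set x] = 0%E.
Proof.
rewrite /= /rV_cons_measure /pushforward.
have mx := measurable_rV_set1 (rV_uncons x).2.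
rewrite (_ : @rV_cons R n @^-1` [set x] = [set (rV_uncons x).1] `*` [set (rV_uncons x).2]).
  rewrite product_measure1E//.
  rewrite [X in (X * _)%E](_ : _ = 0%E) ?mul0e//.
  exact: (lebesgue_measure_set1 (rV_uncons x).1).
apply/seteqP; split => -[a y].
  by move=> h; have := @rV_consK R n (a, y); rewrite (h : rV_cons (a, y) = x) => ->.
move=> /= [-> ->]; apply/rowP => i; rewrite mxE; case: unliftP => [j ->|->] //=.
by rewrite mxE.
Qed.

Lemma enorm_le n L (x : 'rV[R]_n) : 0 <= L -> cube L x -> enorm x <= Num.sqrt n%:R * L.
Proof.
move=> L0 xL; rewrite -[X in _ * X](ger0_norm L0) -sqrtr_sqr -sqrtrM// ler_sqrt ?mulr_ge0 ?sqr_ge0//.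
apply: (@le_trans _ _ (\sum_(i < n) L ^+ 2)); last by rewrite sumr_const card_ord mulr_natl.
apply: ler_sum => i _; rewrite -expr2 -real_normK ?num_real//.
by rewrite ler_pXn2r ?nnegrE.
Qed.

Lemma enorm_gt0 n (x : 'rV[R]_n) : x != 0 -> 0 < enorm x.
Proof.
move=> x0; rewrite /enorm sqrtr_gt0 lt_neqAle sumr_ge0 ?andbT; last first.
  by move=> i _; rewrite -expr2 sqr_ge0.
apply: contra x0; rewrite eq_sym psumr_eq0; last by move=> i _; rewrite -expr2 sqr_ge0.
move=> /allP h; apply/eqP/rowP => i; rewrite mxE.
by have := h i (mem_index_enum _); rewrite /= mulf_eq0 orbb => /eqP.
Qed.

Lemma measurable_cutoff n (a : R) : measurable_fun [set: 'rV[R]_n] (cutoff a).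
Proof.
apply: measurable_prod => i _.
have mm : measurable_fun [set: R] (fun s => mollifier (a * s)).
  apply: continuous_measurable_fun => s.
  have [ds _] := is_derive_bump_scale 1 0 a s.
  exact/differentiable_continuous/derivable1_diffP.
exact: (measurableT_comp mm (measurable_coord i)).
Qed.

Lemma cutoff_cube n (rho : R) (x : 'rV[R]_n) : 0 < rho ->
  cutoff rho^-1 x != 0 -> cube rho x.
Proof.
move=> r0 h i; have := cutoff_neq0 i h.
by rewrite normrM gtr0_norm ?invr_gt0// ltr_pdivrMl// mulr1 => /ltW.
Qed.

Lemma cutoff_ge n (rho : R) (x : 'rV[R]_n) : 0 < rho ->
  cube (rho / 2) x -> expR (- 2) ^+ n <= cutoff rho^-1 x.
Proof.
move=> r0 h; rewrite -[X in _ ^+ X]card_ord -prodr_const.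
apply: ler_prod => i _; rewrite expR_ge0 mollifier_half//.
by rewrite normrM gtr0_norm ?invr_gt0// ler_pdivrMl// h.
Qed.

(** On the cube of half-side [rho / 2], whose volume is exactly [rho ^+ n], each of the [n] factors
    is at least exp(-2). *)
Lemma integral_cutoff_ge n (rho : R) : 0 < rho ->
  ((expR (- 2) ^+ n * rho ^+ n)%:E <= \int[lebesgue_rV R n]_x (cutoff rho^-1 x)%:E)%E.
Proof.
move=> r0; have mB := @measurable_cube n (rho / 2).
have : ((expR (- 2) ^+ n)%:E * lebesgue_rV R n (cube (rho / 2)) <=
    \int[lebesgue_rV R n]_x (cutoff rho^-1 x)%:E)%E.
  rewrite -integral_cst// integral_mkcond; apply: le_integral_ge0 => x _.
    by rewrite lee_fin cutoff_ge0.
  rewrite patchE; case: ifPn => [|_]; last by rewrite lee_fin cutoff_ge0.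
  by rewrite inE => Bx; rewrite lee_fin cutoff_ge.
rewrite lebesgue_cube; last by rewrite divr_ge0// ltW.
by rewrite -EFinM (_ : 2 * (rho / 2) = rho)//; field.
Qed.

End rV_measure.

(** * The test function method *)

Section estimates.
Context {R : realType} (m : nat).
Local Notation n := m.+1.
Local Notation mu := (lebesgue_rV R n).
Implicit Types (rho gam p q : R) (v w : 'rV[R]_n -> R) (x y : 'rV[R]_n).

Lemma riesz_const_gt0 gam : 0 < gam -> gam < n%:R -> 0 < @riesz_const R n gam.
Proof.
move=> g0 gn; rewrite /riesz_const divr_gt0 ?mulr_gt0 ?powR_gt0 ?pi_gt0// ?Gamma_gt0//; lra.
Qed.

Lemma riesz_potential_ge0 gam v x : 0 <= gam -> gam < n%:R ->
  (forall y, 0 <= v y) -> (0 <= riesz_potential gam v x)%E.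
Proof.
move=> g0 gn v0; rewrite /riesz_potential; case: eqVneq => [_|gN0]; first by rewrite lee_fin.
apply: mule_ge0.
  by rewrite lee_fin ltW// riesz_const_gt0// lt_neqAle eq_sym gN0.
by apply: integral_ge0 => y _; rewrite lee_fin mulr_ge0 ?powR_ge0.
Qed.

(* At [y = x] the kernel is [0 `^ _ = 0] instead of being infinite, so the point
   [x], a null set, has to be removed from the cube. *)
Lemma riesz_potential_ge gam rho v x : 0 < gam -> gam < n%:R -> 0 < rho ->
  measurable_fun [set: 'rV[R]_n] v -> (forall y, 0 <= v y) -> cube rho x ->
  ((@riesz_const R n gam * (2 * Num.sqrt n%:R * rho) `^ (- (n%:R - gam)))%:E *
     \int[mu]_(y in cube rho) (v y)%:E <= riesz_potential gam v x)%E.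
Proof.
move=> g0 gn r0 mv v0 xB; rewrite /riesz_potential gt_eqF//.
rewrite EFinM -muleA; apply: lee_wpmul2l.
  by rewrite lee_fin ltW// riesz_const_gt0.
set D := 2 * _ * _; have D0 : 0 < D by rewrite !mulr_gt0// sqrtr_gt0 ltr0n.
have mE : measurable_fun (cube rho) (fun y => (v y)%:E).
  by apply/measurable_EFinP; apply: measurable_funS mv.
have mx := measurable_rV_set1 x.
have mB := @measurable_cube R n rho.
have v0E y : cube rho y -> (0 <= (v y)%:E)%E by rewrite lee_fin.
have mux : mu [set x] = 0%E := lebesgue_rV_set1 x.
rewrite (ge0_negligible_integral mx mB mE v0E mux).
rewrite -ge0_integralZl ?lee_fin ?powR_ge0//; first last.
- by move=> y _; rewrite lee_fin.
- by apply: measurable_funS mE => // y [].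
- exact: measurableD.
rewrite integral_mkcond; apply: le_integral_ge0 => y _.
  by rewrite lee_fin mulr_ge0 ?powR_ge0.
rewrite patchE; case: ifPn => [|_]; last by rewrite lee_fin mulr_ge0 ?powR_ge0.
rewrite inE => -[yB /= yx]; rewrite -EFinM lee_fin ler_wpM2r//.
have xy0 : 0 < enorm (x - y).
  by apply: enorm_gt0; rewrite subr_eq0 eq_sym; apply/eqP.
rewrite !powRN lef_pV2 ?posrE ?powR_gt0//.
apply: ge0_ler_powR; rewrite ?nnegrE ?(ltW D0) ?(ltW xy0)//; first by rewrite subr_ge0 ltW.
(* The difference of two points of the cube lies in the cube of half-side [2 * rho], whence the
   diameter [D]. *)
apply: le_trans (@enorm_le _ _ (2 * rho) _ _ _) _; first by rewrite mulr_ge0// ltW.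
  move=> i; rewrite !mxE (le_trans (ler_normB _ _))//.
  by have := xB i; have := yB i; lra.
by rewrite /D mulrCA mulrA.
Qed.

(** The kernel bound of order rho^(gam - n) on the cube, times the integral of the cutoff, of order
    rho^n, gives rho^gam. The number [c] stands for the value of the time cutoff. *)
Lemma nonlinear_ge gam : 0 <= gam -> gam < n%:R ->
  exists2 A : R, 0 < A & forall rho v (c : R), 0 < rho ->
    measurable_fun [set: 'rV[R]_n] v -> (forall y, 0 <= v y) -> 0 <= c ->
    ((A * rho `^ gam)%:E * \int[mu]_x (v x * (cutoff rho^-1 x * c))%:E <=
     \int[mu]_x (riesz_potential gam v x * (cutoff rho^-1 x * c)%:E))%E.
Proof.
rewrite le_eqVlt => /predU1P[<- _|g0 gn].
  (* For [gam = 0] the potential is the identity and equality holds. *)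
  exists 1 => // rho v c r0 mv v0 c0.
  by rewrite powRr0 mulr1 mul1e /riesz_potential eqxx le_eqVlt; under [X in _ == X]eq_integral do rewrite -EFinM; rewrite eqxx.
pose k : R := @riesz_const R n gam * (2 * Num.sqrt n%:R) `^ (- (n%:R - gam)).
have k0 : 0 < k by rewrite mulr_gt0 ?riesz_const_gt0// powR_gt0// mulr_gt0// sqrtr_gt0 ltr0n.
exists (k * expR (- 2) ^+ n); first by rewrite mulr_gt0 ?exprn_gt0 ?expR_gt0.
move=> rho v c r0 mv v0 c0.
(* [I] may be infinite, so the comparison stays in the extended reals. *)
pose I := (\int[mu]_(y in cube rho) (v y)%:E)%E.
have I0 : (0 <= I)%E by apply: integral_ge0 => y _; rewrite lee_fin.
have mphi := @measurable_cutoff R n rho^-1.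
have mB := @measurable_cube R n rho.
pose a : R := k * rho `^ (- (n%:R - gam)).
have a0 : 0 < a by rewrite mulr_gt0 ?powR_gt0.
have le1 : (\int[mu]_x (v x * (cutoff rho^-1 x * c))%:E <= c%:E * I)%E.
  rewrite /I -ge0_integralZl ?lee_fin//; first last.
  - by move=> y _; rewrite lee_fin.
  - by apply/measurable_EFinP; apply: measurable_funS mv.
  rewrite [leRHS]integral_mkcond; apply: le_integral_ge0 => x _.
    by rewrite patchE; case: ifPn => // _; rewrite mule_ge0 ?lee_fin.
  rewrite patchE; case: ifPn => [_|].
    by rewrite -EFinM lee_fin [leLHS]mulrA (mulrC c) ler_wpM2r// ler_piMr// cutoff_le1.
  rewrite notin_setE => xB; rewrite lee_fin (_ : cutoff _ _ = 0) ?mul0r ?mulr0//.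
  by apply/eqP/negP => /negP /(cutoff_cube r0).
have le2 : (a%:E * I * (c%:E * (expR (- 2) ^+ n * rho ^+ n)%:E) <=
    \int[mu]_x (riesz_potential gam v x * (cutoff rho^-1 x * c)%:E))%E.
  apply: (@le_trans _ _ (\int[mu]_x (a%:E * I * (c%:E * (cutoff rho^-1 x)%:E)))%E).
    rewrite ge0_integralZl ?mule_ge0 ?lee_fin ?(ltW a0)//; first last.
    - by move=> x _; rewrite mule_ge0 ?lee_fin ?cutoff_ge0.
    - by apply: measurable_funeM; apply/measurable_EFinP.
    rewrite ge0_integralZl ?lee_fin//; first last.
    - by move=> x _; rewrite lee_fin cutoff_ge0.
    - exact/measurable_EFinP.
    rewrite lee_wpmul2l ?mule_ge0 ?lee_fin ?(ltW a0)// lee_wpmul2l ?lee_fin//.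
    exact: integral_cutoff_ge.
  apply: le_integral_ge0 => x _.
    by rewrite mule_ge0 ?riesz_potential_ge0 ?(ltW g0)// lee_fin mulr_ge0 ?cutoff_ge0.
  have [->|/(cutoff_cube r0) xB] := eqVneq (cutoff rho^-1 x) 0.
    by rewrite mul0r !mule0.
  rewrite -EFinM (mulrC c) lee_wpmul2r ?lee_fin ?mulr_ge0 ?cutoff_ge0//.
  apply: le_trans (riesz_potential_ge g0 gn r0 mv v0 xB).
  by rewrite [(2 * Num.sqrt n%:R * rho) `^ _]powRM ?(ltW r0) ?mulr_ge0 ?sqrtr_ge0// mulrA.
apply: le_trans le2.
apply: (@le_trans _ _ ((k * expR (- 2) ^+ n * rho `^ gam)%:E * (c%:E * I))%E).
  apply: lee_wpmul2l => //; rewrite lee_fin; apply: mulr_ge0; last exact: powR_ge0.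
  by rewrite mulr_ge0 ?exprn_ge0 ?expR_ge0// ltW.
rewrite (muleC a%:E) !muleA (muleC _ I) -!muleA lee_wpmul2l// -!EFinM lee_fin /a.
have -> : rho `^ gam = rho `^ (- (n%:R - gam)) * rho ^+ n.
  rewrite -powR_mulrn ?(ltW r0)// -powRD ?(gt_eqF r0) ?implybT//.
  by congr (_ `^ _); ring.
by rewrite le_eqVlt; apply/orP; left; apply/eqP; ring.
Qed.

(** On the cube of half-side [rho / 2], [japanese x] is at most sqrt(1 + n) rho because [rho >= 1],
    and its exponent is negative; the volume rho^n turns rho^(q - n) into rho^q. Elsewhere the
    integrand is nonnegative. *)
Lemma data_ge q c w : 0 < q -> q < n%:R -> 0 < c ->
  (forall x, c * japanese x `^ (- n%:R + q) <= w x) ->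
  exists2 A : R, 0 < A & forall rho, 1 <= rho ->
   ((A * rho `^ q)%:E <= \int[mu]_x (w x * cutoff rho^-1 x)%:E)%E.
Proof.
move=> q0 qn c0 hw.
have s0 : 0 < Num.sqrt (1 + n%:R) :> R by rewrite sqrtr_gt0 ltr_wpDr.
exists (c * Num.sqrt (1 + n%:R) `^ (- n%:R + q) * expR (- 2) ^+ n).
  by rewrite !mulr_gt0 ?powR_gt0 ?exprn_gt0 ?expR_gt0.
move=> rho r1; have r0 : 0 < rho by exact: lt_le_trans r1.
have mB := @measurable_cube R n (rho / 2).
have w0 x : 0 <= w x by apply: le_trans (hw x); rewrite mulr_ge0 ?powR_ge0// ltW.
pose b : R := c * (Num.sqrt (1 + n%:R) * rho) `^ (- n%:R + q) * expR (- 2) ^+ n.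
have : (b%:E * mu (cube (rho / 2)) <= \int[mu]_x (w x * cutoff rho^-1 x)%:E)%E.
  rewrite -integral_cst// integral_mkcond; apply: le_integral_ge0 => x _.
    by rewrite lee_fin mulr_ge0 ?cutoff_ge0.
  rewrite patchE; case: ifPn => [|_]; last by rewrite lee_fin mulr_ge0 ?cutoff_ge0.
  rewrite inE => Bx; rewrite lee_fin ler_pM ?exprn_ge0 ?expR_ge0 ?cutoff_ge//.
    by rewrite mulr_ge0 ?powR_ge0// ltW.
  apply: le_trans (hw x); rewrite ler_wpM2l ?(ltW c0)//.
  have -> : - n%:R + q = - (n%:R - q) by ring.
  have j0 : 0 < japanese x by rewrite sqrtr_gt0 ltr_wpDr ?sqr_ge0.
  rewrite !powRN lef_pV2 ?posrE ?powR_gt0 ?mulr_gt0//.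
  apply: ge0_ler_powR; rewrite ?nnegrE ?(ltW j0) ?mulr_ge0 ?(ltW s0) ?(ltW r0)//.
    by rewrite subr_ge0 ltW.
  rewrite -[X in _ * X](ger0_norm (ltW r0)) -sqrtr_sqr -sqrtrM ?addr_ge0//.
  rewrite ler_sqrt ?mulr_ge0 ?addr_ge0 ?sqr_ge0//.
  have e0 : 0 <= enorm x by exact: sqrtr_ge0.
  have h2 : 0 <= rho / 2 by rewrite divr_ge0// ltW.
  have he : enorm x ^+ 2 <= (Num.sqrt n%:R * (rho / 2)) ^+ 2.
    have h := enorm_le h2 Bx; rewrite ler_pXn2r ?nnegrE//.
    by apply: mulr_ge0 => //; exact: sqrtr_ge0.
  rewrite exprMn (@sqr_sqrtr R n%:R)// in he.
  have : 1 <= rho ^+ 2 by rewrite exprn_ege1.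
  have : 0 <= n%:R * rho ^+ 2 by rewrite mulr_ge0// sqr_ge0.
  move: he; rewrite (_ : n%:R * (rho / 2) ^+ 2 = n%:R * rho ^+ 2 / 4); last by field.
  by set z := n%:R * rho ^+ 2; rewrite mulrDl mul1r -/z; lra.
1,2: exact: ltW.
have -> : mu (cube (rho / 2)) = ((2 * (rho / 2)) ^+ n)%:E.
  by apply: lebesgue_cube; rewrite divr_ge0// ltW.
rewrite -EFinM (_ : 2 * (rho / 2) = rho); last by field.
apply: le_trans; rewrite lee_fin /b powRM ?(ltW s0) ?(ltW r0)//.
have -> : rho `^ q = rho `^ (- n%:R + q) * rho ^+ n.
  rewrite -powR_mulrn ?(ltW r0)// -powRD ?(gt_eqF r0) ?implybT//.
  by congr (_ `^ _); ring.
by rewrite le_eqVlt; apply/orP; left; apply/eqP; ring.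
Qed.

End estimates.

(** * The estimate on time slices and its integration in time *)

Section time_slices.
Context {R : realType} (m : nat).
Local Notation n := m.+1.
Local Notation mu := (lebesgue_rV R n).
Local Notation leb := (@lebesgue_measure R).
Implicit Types (rho gam p q : R) (u w : 'rV[R]_n -> R) (x y : 'rV[R]_n).

(** A form of Young's inequality by cases: if k <= A X^(p-1) the first term suffices, otherwise X <
    (k/A)^(1/(p-1)) and the second does. *)
Lemma young_powR (k A X p : R) : 0 < k -> 0 < A -> 0 <= X -> 1 < p ->
  k * X <= A * X `^ p + k * (k / A) `^ (p - 1)^-1.
Proof.
move=> k0 A0 X0 p1; have p10 : 0 < p - 1 by rewrite subr_gt0.
have [kA|Ak] := leP k (A * X `^ (p - 1)).
  apply: (@le_trans _ _ (A * X `^ p)); last by rewrite lerDl mulr_ge0 ?powR_ge0// ltW.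
  rewrite -mulr_powRB1 ?(lt_trans ltr01)// [leRHS]mulrCA mulrC.
  by rewrite ler_wpM2l.
apply: (@le_trans _ _ (k * (k / A) `^ (p - 1)^-1)); last first.
  by rewrite lerDr mulr_ge0 ?powR_ge0// ltW.
rewrite ler_wpM2l ?(ltW k0)//.
have -> : X = (X `^ (p - 1)) `^ (p - 1)^-1 by rewrite -powRrM mulfV ?gt_eqF// powRr1.
apply: ge0_ler_powR; rewrite ?nnegrE ?powR_ge0 ?invr_ge0 ?divr_ge0 ?(ltW k0) ?(ltW A0) ?(ltW p10)//.
by rewrite ler_pdivlMr// mulrC ltW.
Qed.

Lemma measurable_time_interval (T : \bar R) : measurable (time_interval T).
Proof.
case: T => [r| |].
- rewrite (_ : time_interval _ = `[0, r[%classic)//.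
  by apply/seteqP; split => t; rewrite /time_interval/= in_itv/= lte_fin => /andP.
- rewrite (_ : time_interval _ = `[0, +oo[%classic)//.
  by apply/seteqP; split => t; rewrite /time_interval/= in_itv/= andbT ?ltry// => -[].
- rewrite (_ : time_interval _ = set0)//.
  by apply/seteqP; split => t // [].
Qed.

(** Parabolic scaling: with time cut off at rho^2 and space at rho, one time derivative and the
    Laplacian both cost rho^-2. *)
Let time_cutoff rho (t : R) : R := mollifier ((rho ^+ 2)^-1 * t).

Let linear_part rho u (t : R) x : R :=
  u x * (cutoff rho^-1 x * derive1n 2 (time_cutoff rho) t
         - cutoff rho^-1 x * derive1 (time_cutoff rho) t
         - time_cutoff rho t * laplacian (cutoff rho^-1) x).

(** The second time derivative costs rho^-4 <= rho^-2 because [rho >= 1]. Undifferentiated cutoffs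
    lie in [0, 1], hence below their own power [p^-1]. *)
Lemma linear_part_le p : 1 < p -> exists2 k : R, 0 < k &
  forall rho u t x, 1 <= rho ->
  `|linear_part rho u t x| <=
  k / rho ^+ 2 * (`|u x| * (cutoff rho^-1 x * time_cutoff rho t) `^ p^-1).
Proof.
move=> p1; have p0 : 0 < p by exact: lt_trans p1.
have r01 : 0 < p^-1 < 1 by rewrite invr_gt0 p0 invf_lt1.
have [Ct Ct0 Ht] := @mollifier_deriv_le R _ r01.
have [Cx Cx0 Hx] := @laplacian_cutoff_le R n _ r01.
exists (Ct + Ct + Cx); first by rewrite !addr_gt0.
move=> rho u t x r1; have r0 : 0 < rho by exact: lt_le_trans r1.
rewrite /linear_part normrM mulrCA ler_wpM2l//.
rewrite powRM ?cutoff_ge0 ?mollifier_ge0//.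
have [Ht1 Ht2] := Ht (rho ^+ 2)^-1 t; have {Hx} := Hx rho^-1 x.
rewrite -/(time_cutoff rho) in Ht1 Ht2.
rewrite -[mollifier _]/(time_cutoff rho t) in Ht1 Ht2.
set a := (rho ^+ 2)^-1 in Ht1 Ht2 *; rewrite exprVn -/a.
have a0 : 0 < a by rewrite invr_gt0 exprn_gt0.
have a1 : a <= 1 by rewrite invf_le1 ?exprn_gt0// exprn_ege1.
have ph0 : 0 <= cutoff rho^-1 x by exact: cutoff_ge0.
have ph1 : cutoff rho^-1 x <= cutoff rho^-1 x `^ p^-1.
  move: ph0; rewrite le_eqVlt => /predU1P[<-|ph0]; first exact: powR_ge0.
  by rewrite ger1_powR ?ph0 ?cutoff_le1// invf_le1// ltW.
have ch0 : 0 <= time_cutoff rho t by exact: mollifier_ge0.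
have ch1 : time_cutoff rho t <= time_cutoff rho t `^ p^-1.
  by apply: mollifier_le_powR; rewrite invr_gt0 p0 invf_le1// ltW.
rewrite (ger0_norm (ltW a0)) in Ht1.
have {}Ht2 : `|derive1n 2 (time_cutoff rho) t| <= a * Ct * time_cutoff rho t `^ p^-1.
  apply: le_trans Ht2 _; rewrite ler_wpM2r ?powR_ge0// ler_wpM2r ?(ltW Ct0)//.
  by rewrite expr2 ler_piMr// ltW.
move: ph0 ph1 ch0 ch1 Ht1 Ht2.
set P := cutoff rho^-1 x; set Pr := P `^ _; set H := time_cutoff rho t; set Hr := H `^ _.
set D1 := derive1 _ _; set D2 := derive1n _ _ _; set L := laplacian _ _.
move=> P0 PPr H0 HHr h1 h2 h3.
rewrite (le_trans (ler_normB _ _))// mulrDl mulrDl mulrDl mulrDl; apply: lerD.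
  rewrite (le_trans (ler_normB _ _))//; apply: lerD.
    rewrite normrM (ger0_norm P0) [leRHS](_ : _ = Pr * (a * Ct * Hr)); last by ring.
    exact: ler_pM.
  rewrite normrM (ger0_norm P0) [leRHS](_ : _ = Pr * (a * Ct * Hr)); last by ring.
  exact: ler_pM.
rewrite normrM (ger0_norm H0) [leRHS](_ : _ = Hr * (a * Cx * Pr)); last by ring.
exact: ler_pM.
Qed.

(** Apply [young_powR] to X = |u| (phi chi)^(1/p) with k' = k rho^-2 and a = A rho^gam. By
    [nonlinear_ge], the integral of a X^p is at most the nonlinear term; the remainder is a constant
    on a cube of volume (2 rho)^n. *)
Lemma slice_le gam p : 0 <= gam -> gam < n%:R -> 1 < p ->
  exists2 K : R, 0 < K & forall rho u (t : R), 1 <= rho -> 0 <= t ->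
    measurable_fun [set: 'rV[R]_n] u ->
    (\int[mu]_x (linear_part rho u t x)%:E <=
     \int[mu]_x (riesz_potential gam (fun y => `|u y| `^ p)%R x *
                 (cutoff rho^-1 x * time_cutoff rho t)%:E) +
     (K * rho `^ (n%:R - 2 - (2 + gam) / (p - 1)) * (t <= rho ^+ 2)%R%:R)%:E)%E.
Proof.
move=> g0 gn p1; have p0 : 0 < p by exact: lt_trans p1.
have [A A0 HA] := @nonlinear_ge R m gam g0 gn.
have [k k0 Hk] := linear_part_le p1.
exists (k * (k / A) `^ (p - 1)^-1 * 2 ^+ n).
  by rewrite !mulr_gt0 ?powR_gt0 ?divr_gt0 ?exprn_gt0.
move=> rho u t r1 t0 mu_; have r0 : 0 < rho by exact: lt_le_trans r1.
pose v y := `|u y| `^ p.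
have v0 y : 0 <= v y by exact: powR_ge0.
have mv : measurable_fun setT v.
  apply: (measurableT_comp (measurable_powR p)).
  exact: (measurableT_comp (@normr_measurable R setT) mu_).
have ch0 : 0 <= time_cutoff rho t by exact: mollifier_ge0.
have {HA} := HA rho v _ r0 mv v0 ch0; set Nt := (X in (_ <= X)%E) => HA.
have HX x : linear_part rho u t x <=
    k / rho ^+ 2 * (`|u x| * (cutoff rho^-1 x * time_cutoff rho t) `^ p^-1).
  exact: le_trans (ler_norm _) (Hk _ _ _ _ r1).
have ip0 : p^-1 != 0 by rewrite invr_eq0 gt_eqF.
(* Past rho^2 the time cutoff vanishes, and the bound [HX] with it, since 0 to the nonzero power
   [p^-1] is 0. *)
have [tr|rt] := leP t (rho ^+ 2); last first.
  have ch : time_cutoff rho t = 0.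
    rewrite /time_cutoff /mollifier bump_out// normrM gtr0_norm ?invr_gt0 ?exprn_gt0//.
    by rewrite ler_pdivlMl ?exprn_gt0// mulr1 (le_trans (ltW rt))// ler_norm.
  rewrite mulr0 adde0 -/Nt; apply: le_trans HA.
  apply: (@le_trans _ _ 0%E); last first.
    rewrite mule_ge0 ?lee_fin ?mulr_ge0 ?powR_ge0 ?(ltW A0)//.
    by apply: integral_ge0 => x _; rewrite lee_fin !mulr_ge0 ?cutoff_ge0.
  rewrite -(integral0 mu [set: 'rV[R]_n]); apply: le_integral_ge0 => // x _.
  by have := HX x; rewrite ch mulr0 powR0// !mulr0 lee_fin.
pose a := A * rho `^ gam; have a0 : 0 < a by rewrite mulr_gt0 ?powR_gt0.
pose k' := k / rho ^+ 2; have k'0 : 0 < k' by rewrite divr_gt0// exprn_gt0.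
pose B := k' * (k' / a) `^ (p - 1)^-1.
have B0 : 0 < B by apply: mulr_gt0 => //; apply: powR_gt0; exact: divr_gt0.
have mB := @measurable_cube R n rho.
have mphi := @measurable_cutoff R n rho^-1.
pose F x : R := v x * (cutoff rho^-1 x * time_cutoff rho t).
have F0 x : 0 <= F x by rewrite !mulr_ge0 ?cutoff_ge0.
have mF : measurable_fun [set: 'rV[R]_n] (fun x => (F x)%:E).
  apply/measurable_EFinP; apply: measurable_funM => //.
  by apply: measurable_funM => //; exact: measurable_cst.
apply: (@le_trans _ _ (\int[mu]_x (a%:E * (F x)%:E + (cst B%:E \_ (cube rho)) x))%E).
  apply: le_integral_ge0 => x _.
    rewrite adde_ge0 ?mule_ge0 ?lee_fin ?(ltW a0)//.
    by rewrite patchE; case: ifPn => // _; rewrite lee_fin ltW.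
  apply: (@le_trans _ _ (k' * (`|u x| * (cutoff rho^-1 x * time_cutoff rho t) `^ p^-1))%:E).
    by rewrite lee_fin HX.
  rewrite patchE; case: ifPn => [_|].
    rewrite -EFinM -EFinD lee_fin.
    have X0 : 0 <= `|u x| * (cutoff rho^-1 x * time_cutoff rho t) `^ p^-1.
      by rewrite mulr_ge0 ?powR_ge0.
    apply: le_trans (young_powR k'0 a0 X0 p1) _.
    rewrite lerD2r ler_wpM2l ?(ltW a0)// [leLHS]powRM ?powR_ge0//.
    by rewrite -powRrM mulVf ?gt_eqF// powRr1 ?mulr_ge0 ?cutoff_ge0.
  rewrite notin_setE => xB; rewrite adde0 (_ : cutoff _ _ = 0).
    by rewrite mul0r powR0// !mulr0 -EFinM lee_fin mulr_ge0 ?(ltW a0).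
  by apply/eqP/negP => /negP /(cutoff_cube r0).
rewrite ge0_integralD//; first last.
- by apply/measurable_restrict => //; exact: measurable_cst.
- by move=> x _; rewrite patchE; case: ifPn => // _; rewrite lee_fin ltW.
- by apply: measurable_funeM.
- by move=> x _; rewrite mule_ge0 ?lee_fin ?(ltW a0).
apply: leeD.
  rewrite ge0_integralZl ?lee_fin ?(ltW a0)//.
  by move=> x _; rewrite lee_fin.
rewrite -integral_mkcond integral_cst//.
rewrite [X in (_ * X)%E](_ : _ = ((2 * rho) ^+ n)%:E); last by apply: lebesgue_cube; exact: ltW.
rewrite -EFinM lee_fin mulr1 le_eqVlt; apply/orP; left; apply/eqP.
rewrite /B /k' /a exprMn.
(* Power counting: k'/a scales like rho^-(2 + gam), and is then raised to the power 1/(p - 1). *)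
have -> : k / rho ^+ 2 / (A * rho `^ gam) = k / A * rho `^ (- (2 + gam)).
  rewrite powRN powRD ?(gt_eqF r0) ?implybT// powR_mulrn ?(ltW r0)//.
  by field; rewrite !gt_eqF ?powR_gt0.
rewrite powRM ?powR_ge0 ?divr_ge0 ?(ltW k0) ?(ltW A0)// -powRrM.
have -> : rho `^ (n%:R - 2 - (2 + gam) / (p - 1)) =
   rho ^+ n / rho ^+ 2 * rho `^ (- (2 + gam) / (p - 1)).
  rewrite mulNr powRD ?(gt_eqF r0) ?implybT// powRB ?(gt_eqF r0) ?implybT//.
  by rewrite !powR_mulrn ?(ltW r0).
by ring.
Qed.

(** Integrates [slice_le] in time: its remainder lives on [0, rho^2] and so gains a factor rho^2,
    which cancels the -2 in the exponent. *)
Lemma weak_solution_le gam p q w0 w1 : 0 <= gam -> gam < n%:R -> 1 < p ->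
  forall c : R, 0 < q -> q < n%:R -> 0 < c ->
  (forall x, c * japanese x `^ (- n%:R + q) <= w0 x + w1 x) ->
  exists2 K : R, 0 < K & forall (eps : R) rho T (U : R -> 'rV[R]_n -> R),
    0 < eps -> 1 <= rho -> ((rho ^+ 2)%:E < T)%E ->
    weak_solution gam p eps w0 w1 T U ->
    eps * rho `^ q <= K * rho `^ (n%:R - (2 + gam) / (p - 1)).
Proof.
move=> g0 gn p1 c q0 qn c0 hw.
have [K K0 HK] := slice_le g0 gn p1.
have [D D0 HD] := data_ge q0 qn c0 hw.
pose z := expR (- 2) * D; have z0 : 0 < z by rewrite mulr_gt0 ?expR_gt0.
exists (K / z); first by rewrite divr_gt0.
move=> eps rho T U e0 r1 rT [[LU _] HU]; have r0 : 0 < rho by exact: lt_le_trans r1.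
have r20 : 0 < rho ^+ 2 by rewrite exprn_gt0.
have ri0 : 0 < rho^-1 by rewrite invr_gt0.
have := HU (time_cutoff rho) (cutoff rho^-1) (mollifier_time_test r20 rT)
  (test_function_cutoff ri0) => -[].
set NL := fun t x => _; set LL := fun t x => _ => -[_ iN] [_ iL] _ _.
(* The time cutoff is flat at 0, so only the data term with [w0 + w1] survives. *)
rewrite (_ : derive1 _ 0 = 0) ?derive1_mollifier0// mulr0 mul0e sube0.
rewrite /iterated_integral; set I := time_interval T => E.
have IT t : I t -> 0 <= t by case.
have mI : measurable I by exact: measurable_time_interval.
have N0 t : (0 <= \int[mu]_x NL t x)%E.
  apply: integral_ge0 => x _; apply: mule_ge0.
    by apply: riesz_potential_ge0 => // y; exact: powR_ge0.
  by rewrite lee_fin mulr_ge0 ?cutoff_ge0 ?mollifier_ge0.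
pose k := K * rho `^ (n%:R - 2 - (2 + gam) / (p - 1)).
have k0 : 0 < k by rewrite mulr_gt0 ?powR_gt0.
pose J := `[0, rho ^+ 2]%classic : set R.
have mJ : measurable J by exact: measurable_itv.
have le1 : (\int[leb]_(t in I) \int[mu]_x LL t x <=
    \int[leb]_(t in I) (\int[mu]_x NL t x + (cst k%:E \_ J) t))%E.
  apply: le_integral_ge0 => t It.
    rewrite adde_ge0//.
    by rewrite patchE; case: ifPn => // _; rewrite lee_fin ltW.
  have mU : measurable_fun setT (U t).
    by have := sub_Lfun_mfun (LU _ It); rewrite inE.
  apply: le_trans (HK rho (U t) t r1 (IT _ It) mU) _.
  rewrite leeD2l// patchE; case: ifPn => [_|].
    by rewrite lee_fin -/k ler_piMr ?(ltW k0)// lern1 leq_b1.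
  rewrite notin_setE /J/= in_itv/= (IT _ It)/= => /negP/negbTE ->.
  by rewrite mulr0.
have mN : measurable_fun I (fun t => \int[mu]_x NL t x)%E by exact: measurable_int iN.
have mcJ : measurable_fun I (cst k%:E \_ J : R -> \bar R)%E.
  by apply: (iffLR (measurable_restrict _ mJ mI)); exact: measurable_cst.
have cJ0 t : I t -> (0 <= (cst k%:E \_ J : R -> \bar R) t)%E.
  by move=> _; rewrite patchE; case: ifPn => // _; rewrite lee_fin ltW.
rewrite (ge0_integralD leb mI (fun t _ => N0 t) mN cJ0 mcJ) in le1.
(* Finiteness, part of the weak formulation, allows the nonlinear integral to be subtracted from
   both sides. *)
have Nfin : (\int[leb]_(t in I) \int[mu]_x NL t x)%E \is a fin_num.
  exact: (@integrable_fin_num _ _ _ leb I).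
have le2 : (\int[leb]_(t in I) (cst k%:E \_ J) t <= (k * rho ^+ 2)%:E)%E.
  rewrite -integral_mkcondr (_ : I `&` J = J).
    by rewrite integral_cst//= lebesgue_measure_itv/= lte_fin r20 -EFinB subr0 -EFinM.
  apply/seteqP; split => [t []//|t tr]; split=> //.
  move: tr; rewrite /J/= in_itv/= => /andP[t0 tr]; split=> //.
  by apply: le_lt_trans rT; rewrite lee_fin.
have {le1 le2} : (\int[leb]_(t in I) \int[mu]_x LL t x <=
    \int[leb]_(t in I) \int[mu]_x NL t x + (k * rho ^+ 2)%:E)%E.
  by apply: le_trans le1 _; rewrite leeD2l.
rewrite -E leeD2lE// => le3.
(* The value at 0 is in fact exp(-1); the cruder bound is enough. *)
have ch0 : expR (- 2) <= time_cutoff rho 0.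
  by apply: mollifier_half; rewrite mulr0 normr0 invr_ge0.
have := HD rho r1 => le4.
have : ((eps * expR (- 2) * (D * rho `^ q))%:E <= (k * rho ^+ 2)%:E)%E.
  apply: le_trans le3; rewrite EFinM; apply: lee_pmul => //.
  - by rewrite lee_fin mulr_ge0 ?expR_ge0 ?(ltW e0).
  - by rewrite lee_fin mulr_ge0 ?powR_ge0 ?(ltW D0).
  - by rewrite lee_fin ler_wpM2l// ltW.
rewrite lee_fin => h; rewrite [leRHS]mulrAC ler_pdivlMr//.
apply: le_trans (_ : k * rho ^+ 2 <= _); first by apply: le_trans h; rewrite le_eqVlt; apply/orP; left; apply/eqP; rewrite /z; ring.
rewrite /k -mulrA ler_wpM2l ?(ltW K0)//.
rewrite -powR_mulrn ?(ltW r0)// -powRD ?(gt_eqF r0) ?implybT//.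
by rewrite le_eqVlt; apply/orP; left; apply/eqP; congr (_ `^ _); ring.
Qed.

End time_slices.

(** * From the inequality in [rho] to the lifespan *)

Theorem proposition3p1 (R : realType) (n : nat) (q gam p c : R)
    (u0 u1 : 'rV[R]_n -> R)
    (hn : (1 <= n)%N)
    (hq0 : 0 < q) (hqn : q < n%:R / 2)
    (hgam0 : 0 <= gam) (hgamn : gam < n%:R)
    (hp1 : 1 < p) (hp : p < p_crit n q gam)
    (hu0 : pseudo_measure_function q u0)
    (hu1 : pseudo_measure_function q u1)
    (hc : 0 < c)
    (hlow : forall x : 'rV[R]_n,
       c * japanese x `^ (- n%:R + q) <= u0 x + u1 x) :
  exists eps1 C : R, 0 < eps1 /\ 0 < C /\
    forall eps : R, 0 < eps -> eps <= eps1 ->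
      (lifespan gam p eps u0 u1 <=
        (C * eps `^ (- (2 * (p - 1) / (2 + gam - (p - 1) * (n%:R - q)))))%:E)%E.
Proof.
case: n => [//|m] in u0 u1 hn hqn hgamn hp hu0 hu1 hlow *.
set kap := 2 * (p - 1) / _.
have p10 : 0 < p - 1 by rewrite subr_gt0.
have n0 : 1 <= m.+1%:R :> R by rewrite ler1n.
have qn : q < m.+1%:R by lra.
have d0 : 0 < 2 + gam - (p - 1) * (m.+1%:R - q).
  by move: hp; rewrite /p_crit addrC -ltrBlDr ltr_pdivlMr ?subr_gt0.
set d := 2 + gam - _ in d0 kap *.
have kap0 : 0 < kap by rewrite divr_gt0// mulr_gt0.
have [K K0 HK] := weak_solution_le hgam0 hgamn hp1 hq0 qn hc hlow.
(* The summand 1 and [eps <= 1] ensure [1 <= B], so that r = rho^2 may be taken up to [B]; it also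
   makes [KB] strict. *)
exists 1, (1 + K `^ kap); split=> //.
have C0 : 0 < 1 + K `^ kap by rewrite ltr_pwDl// powR_ge0.
split=> // eps e0 e1.
set B := _ * _ `^ _.
have ek1 : 1 <= eps `^ (- kap).
  have : eps `^ 0 <= eps `^ (- kap) by rewrite ger_powR ?e0// oppr_le0 ltW.
  by rewrite powRr0.
have B1 : 1 <= B.
  by rewrite /B mulrDl mul1r ler_wpDr// mulr_ge0 ?powR_ge0.
have KB : (K / eps) `^ kap < B.
  rewrite powRM ?invr_ge0 ?(ltW K0) ?(ltW e0)// -powR_inv1 ?(ltW e0)// -powRrM mulN1r.
  by rewrite /B mulrDl ltrDr mul1r (lt_le_trans ltr01).
have small (T : \bar R) U r : weak_solution gam p eps u0 u1 T U ->
    1 <= r -> (r%:E < T)%E -> r < B.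
  move=> HU r1 rT; apply: le_lt_trans KB.
  have r0 : 0 < r by exact: lt_le_trans r1.
  pose rho := Num.sqrt r.
  have rho1 : 1 <= rho by rewrite -sqrtr1 ler_sqrt// ltW.
  have rho0 : 0 < rho by exact: lt_le_trans rho1.
  have rr : rho ^+ 2 = r by rewrite sqr_sqrtr// ltW.
  rewrite -rr in rT; have := HK eps rho T U e0 rho1 rT HU.
  (* Writing the exponent as q - d/(p - 1) lets rho^q cancel, leaving rho^(d/(p-1)) <= K / eps; the
     power [kap] of this bounds rho^2 = r. *)
  rewrite (_ : _ - _ / _ = q + - (d / (p - 1))); last first.
    by rewrite /d; field; rewrite gt_eqF.
  rewrite powRD ?(gt_eqF rho0) ?implybT// mulrCA [leLHS]mulrC ler_pM2l ?powR_gt0//.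
  rewrite powRN ler_pdivlMr ?powR_gt0// mulrC -ler_pdivlMr// => h.
  have -> : r = (rho `^ (d / (p - 1))) `^ kap.
    rewrite -powRrM (_ : _ * kap = 2%:R) ?powR_mulrn ?(ltW rho0)//.
    by rewrite /kap; field; rewrite !gt_eqF.
  apply: ge0_ler_powR => //; rewrite ?nnegrE ?powR_ge0//; first exact: ltW.
  by rewrite divr_ge0// ltW.
apply: ge_ereal_sup => T [->|[T0 [U HU]]].
  by rewrite lee_fin (le_trans ler01).
rewrite leNgt; apply/negP => BT.
(* Any [r] in [B, T) contradicts [small]: the midpoint of [B] and [T] if [T] is finite, [B] itself
   if [T] is infinite. *)
suff [r rB rT] : exists2 r : R, B <= r & (r%:E < T)%E.
  by have := small T U r HU (le_trans B1 rB) rT; rewrite ltNge rB.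
case: T BT {T0 HU} => [t| |//].
  by rewrite lte_fin => Bt; exists ((B + t) / 2); rewrite ?lte_fin; lra.
by move=> _; exists B; rewrite ?ltry.
Qed.
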